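(* Any superconformal Willmore surface $f\colon M^2\to\mathbb{R}^5$ is S-Willmore.
   Context: $M^2$ is a two-dimensional manifold with the metric induced by the immersion $f$; $N_fM$ is the normal bundle, $\nabla^\perp$ the normal connection, $\alpha_f$ the second fundamental form and $H=\frac12\mathrm{trace}\,\alpha_f$ the mean curvature vector field. $f$ is superconformal if at every $p\in M^2$ the ellipse of curvature $\mathcal{E}(p)=\{\alpha_f(X,X):X\in T_pM,\ |X|=1\}$ is a nondegenerate circle. $f$ is Willmore if $\Delta^\perp H-2|H|^2H+\sum_{i,j=1}^2\langle H,\alpha_{ij}\rangle\alpha_{ij}=0$, where $\Delta^\perp$ is the Laplacian in $N_fM$, $\alpha_{ij}=\alpha_f(X_i,X_j)$ and $\{X_1,X_2\}$ is a local orthonormal tangent frame. $f$ is S-Willmore if, for every local complex coordinate $z=y_1+iy_2$ associated to isothermal coordinates, $\nabla^\perp_{\partial_{\bar z}}\alpha_f(\partial_z,\partial_z)$ is parallel to (a complex multiple of) $\alpha_f(\partial_z,\partial_z)$, where $\alpha_f$ and $\nabla^\perp$ are extended complex linearly. *)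

(* Defs.v *)
From mathcomp Require Import all_boot all_order all_algebra.
From mathcomp Require Import all_classical all_reals all_analysis.
From mathcomp Require Import complex.

Set Implicit Arguments.
Unset Strict Implicit.
Unset Printing Implicit Defensive.

Import Order.TTheory GRing.Theory Num.Theory.
Import numFieldNormedType.Exports.

Local Open Scope classical_set_scope.
Local Open Scope ring_scope.

Definition dotv (R : realType) (n : nat) (v w : 'rV[R]_n) : R :=
  \sum_(k < n) v 0 k * w 0 k.

Definition basisv (R : realType) (n : nat) (i : 'I_n) : 'rV[R]_n := delta_mx 0 i.

Definition iter_partial (R : realType) (m n : nat) (s : seq 'I_m)
    (h : 'rV[R]_m -> 'rV[R]_n) : 'rV[R]_m -> 'rV[R]_n :=
  foldr (fun i k => 'D_(basisv R i) k) h s.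

(* C^infinity on an open set U: all iterated partial derivatives exist and are
   continuous at every point of U.  ('D is total, so existence must be asked
   for explicitly.) *)
Definition smooth_on (R : realType) (m n : nat) (U : set 'rV[R]_m)
    (h : 'rV[R]_m -> 'rV[R]_n) : Prop :=
  forall (s : seq 'I_m) (u : 'rV[R]_m), U u ->
    {for u, continuous (iter_partial s h)} /\
    forall i : 'I_m, derivable (iter_partial s h) u (basisv R i).

(* A homeomorphism between open subsets of M and of R^2; chart_fun and its
   inverse chart_inv are total functions whose values outside chart_dom,
   resp. chart_img, are irrelevant. *)
Record chart (R : realType) (M : topologicalType) := Chart {
  chart_dom : set M;
  chart_img : set 'rV[R]_2;
  chart_fun : M -> 'rV[R]_2;
  chart_inv : 'rV[R]_2 -> M;
  chart_dom_open : open chart_dom;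
  chart_img_open : open chart_img;
  chart_fun_img : forall p, chart_dom p -> chart_img (chart_fun p);
  chart_inv_dom : forall u, chart_img u -> chart_dom (chart_inv u);
  chart_funK : forall p, chart_dom p -> chart_inv (chart_fun p) = p;
  chart_invK : forall u, chart_img u -> chart_fun (chart_inv u) = u;
  chart_fun_cont : forall p, chart_dom p -> {for p, continuous chart_fun};
  chart_inv_cont : forall u, chart_img u -> {for u, continuous chart_inv}
}.

Definition smooth_transition (R : realType) (M : topologicalType)
    (c d : chart R M) : Prop :=
  smooth_on (chart_img c `&` chart_inv c @^-1` chart_dom d)
            (chart_fun d \o chart_inv c).

Definition compatible (R : realType) (M : topologicalType) (c d : chart R M) : Prop :=
  smooth_transition c d /\ smooth_transition d c.

(* Two-dimensional smooth manifold, given by its maximal atlas. *)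
Record surface (R : realType) := Surface {
  surface_space :> topologicalType;
  surface_hausdorff : hausdorff_space surface_space;
  surface_second_countable : @second_countable surface_space;
  atlas : set (chart R surface_space);
  atlas_cover : forall p : surface_space, exists2 c, atlas c & chart_dom c p;
  atlas_compatible : forall c d, atlas c -> atlas d -> compatible c d;
  atlas_maximal : forall c, (forall d, atlas d -> compatible c d) -> atlas c
}.

(* The geometry of an immersed surface is written in terms of a local
   parametrization x = f \o chart_inv c, an R^n-valued map near points of R^2.
   Tangent vectors are given by their components in the coordinate frame, a
   vector field is a map 'rV_2 -> 'rV_2, and X = (X^1, X^2) is identified with
   the vector f_* X = 'D_X x of R^n.  Sections of the normal bundle are
   R^n-valued maps. *)

Definition metric (R : realType) (n : nat) (x : 'rV[R]_2 -> 'rV[R]_n)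
    (u : 'rV[R]_2) : 'M[R]_2 :=
  \matrix_(i, j) dotv ('D_(basisv R i) x u) ('D_(basisv R j) x u).

Definition inner (R : realType) (n : nat) (x : 'rV[R]_2 -> 'rV[R]_n)
    (u : 'rV[R]_2) (X Y : 'rV[R]_2) : R :=
  \sum_(i < 2) \sum_(j < 2) X 0 i * Y 0 j * metric x u i j.

(* Orthogonal projection of R^n onto the normal space of x at u. *)
Definition normal_part (R : realType) (n : nat) (x : 'rV[R]_2 -> 'rV[R]_n)
    (u : 'rV[R]_2) (v : 'rV[R]_n) : 'rV[R]_n :=
  v - \sum_(i < 2) \sum_(j < 2)
        (invmx (metric x u) i j * dotv v ('D_(basisv R j) x u))
          *: 'D_(basisv R i) x u.

Definition second_ff (R : realType) (n : nat) (x : 'rV[R]_2 -> 'rV[R]_n)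
    (X Y : 'rV[R]_2 -> 'rV[R]_2) (u : 'rV[R]_2) : 'rV[R]_n :=
  normal_part x u ('D_(X u) (fun w => 'D_(Y w) x w) u).

Definition normal_conn (R : realType) (n : nat) (x : 'rV[R]_2 -> 'rV[R]_n)
    (X : 'rV[R]_2 -> 'rV[R]_2) (eta : 'rV[R]_2 -> 'rV[R]_n) (u : 'rV[R]_2) :
    'rV[R]_n :=
  normal_part x u ('D_(X u) eta u).

Definition dmetric (R : realType) (n : nat) (x : 'rV[R]_2 -> 'rV[R]_n)
    (u : 'rV[R]_2) (l i j : 'I_2) : R :=
  'D_(basisv R l) (fun w => metric x w i j) u.

Definition christoffel (R : realType) (n : nat) (x : 'rV[R]_2 -> 'rV[R]_n)
    (u : 'rV[R]_2) (k i j : 'I_2) : R :=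
  2^-1 * \sum_(l < 2) invmx (metric x u) k l *
    (dmetric x u i j l + dmetric x u j i l - dmetric x u l i j).

Definition levi_civita (R : realType) (n : nat) (x : 'rV[R]_2 -> 'rV[R]_n)
    (X Y : 'rV[R]_2 -> 'rV[R]_2) (u : 'rV[R]_2) : 'rV[R]_2 :=
  'D_(X u) Y u +
  \row_(k < 2) \sum_(i < 2) \sum_(j < 2)
     X u 0 i * Y u 0 j * christoffel x u k i j.

(* Trace, with respect to the induced metric, of a tensor B taking two vector
   fields to a section. *)
Definition metric_trace (R : realType) (n : nat) (x : 'rV[R]_2 -> 'rV[R]_n)
    (B : ('rV[R]_2 -> 'rV[R]_2) -> ('rV[R]_2 -> 'rV[R]_2) ->
         'rV[R]_2 -> 'rV[R]_n)
    (u : 'rV[R]_2) : 'rV[R]_n :=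
  \sum_(i < 2) \sum_(j < 2)
    invmx (metric x u) i j *: B (cst (basisv R i)) (cst (basisv R j)) u.

Definition mean_curvature (R : realType) (n : nat) (x : 'rV[R]_2 -> 'rV[R]_n)
    (u : 'rV[R]_2) : 'rV[R]_n :=
  2^-1 *: metric_trace x (second_ff x) u.

Definition normal_hessian (R : realType) (n : nat) (x : 'rV[R]_2 -> 'rV[R]_n)
    (eta : 'rV[R]_2 -> 'rV[R]_n) (X Y : 'rV[R]_2 -> 'rV[R]_2) (u : 'rV[R]_2) :
    'rV[R]_n :=
  normal_conn x X (normal_conn x Y eta) u - normal_conn x (levi_civita x X Y) eta u.

Definition normal_laplacian (R : realType) (n : nat) (x : 'rV[R]_2 -> 'rV[R]_n)
    (eta : 'rV[R]_2 -> 'rV[R]_n) (u : 'rV[R]_2) : 'rV[R]_n :=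
  metric_trace x (normal_hessian x eta) u.

Definition curvature_ellipse (R : realType) (n : nat) (x : 'rV[R]_2 -> 'rV[R]_n)
    (u : 'rV[R]_2) : set 'rV[R]_n :=
  [set second_ff x (cst X) (cst X) u | X in [set X | Num.sqrt (inner x u X X) = 1]].

(* Circle of positive radius in some affine plane of R^n. *)
Definition nondegenerate_circle (R : realType) (n : nat) (S : set 'rV[R]_n) : Prop :=
  exists (o e1 e2 : 'rV[R]_n) (r : R),
    [/\ 0 < r, dotv e1 e1 = 1, dotv e2 e2 = 1, dotv e1 e2 = 0 &
        S = [set o + (r * cos t) *: e1 + (r * sin t) *: e2 | t in setT]].

Definition re_row (R : realType) (n : nat) (Z : 'rV[R[i]]_n) : 'rV[R]_n :=
  map_mx (@complex.Re R) Z.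

Definition im_row (R : realType) (n : nat) (Z : 'rV[R[i]]_n) : 'rV[R]_n :=
  map_mx (@complex.Im R) Z.

Definition complex_row (R : realType) (n : nat) (a b : 'rV[R]_n) : 'rV[R[i]]_n :=
  \row_k Complex (a 0 k) (b 0 k).

(* Complex bilinear extension of a real bilinear operation on fields. *)
Definition complexify (R : realType) (m n k : nat)
    (B : ('rV[R]_2 -> 'rV[R]_m) -> ('rV[R]_2 -> 'rV[R]_n) -> 'rV[R]_2 -> 'rV[R]_k)
    (Z : 'rV[R]_2 -> 'rV[R[i]]_m) (W : 'rV[R]_2 -> 'rV[R[i]]_n)
    (u : 'rV[R]_2) : 'rV[R[i]]_k :=
  let a := @re_row R m \o Z in let b := @im_row R m \o Z in
  let c := @re_row R n \o W in let d := @im_row R n \o W in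
  complex_row (B a c u - B b d u) (B a d u + B b c u).

Definition d_z (R : realType) : 'rV[R]_2 -> 'rV[R[i]]_2 :=
  cst (complex_row (2^-1 *: basisv R 0) (- 2^-1 *: basisv R 1)).

Definition d_zbar (R : realType) : 'rV[R]_2 -> 'rV[R[i]]_2 :=
  cst (complex_row (2^-1 *: basisv R 0) (2^-1 *: basisv R 1)).

Definition isothermal (R : realType) (n : nat) (x : 'rV[R]_2 -> 'rV[R]_n)
    (U : set 'rV[R]_2) : Prop :=
  forall u, U u -> exists2 lambda : R, 0 < lambda & metric x u = (lambda ^+ 2)%:M.

Definition smooth_immersion (R : realType) (M : surface R) (n : nat)
    (f : M -> 'rV[R]_n) : Prop :=
  forall c : chart R M, atlas c ->
    smooth_on (chart_img c) (f \o chart_inv c) /\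
    forall u, chart_img c u -> injective (fun X => 'D_X (f \o chart_inv c) u).

Definition superconformal (R : realType) (M : surface R) (n : nat)
    (f : M -> 'rV[R]_n) : Prop :=
  forall c : chart R M, atlas c -> forall p : M, chart_dom c p ->
    nondegenerate_circle (curvature_ellipse (f \o chart_inv c) (chart_fun c p)).

(* X is an orthonormal tangent frame at u; the terms in which it occurs are
   tensorial, so only its values at u matter. *)
Definition willmore (R : realType) (M : surface R) (n : nat)
    (f : M -> 'rV[R]_n) : Prop :=
  forall c : chart R M, atlas c -> forall u, chart_img c u ->
  let x := f \o chart_inv c in
  let H := mean_curvature x in
  forall X : 'I_2 -> 'rV[R]_2,
  (forall i j, inner x u (X i) (X j) = (i == j)%:R) ->
  let alpha i j := second_ff x (cst (X i)) (cst (X j)) u in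
  normal_laplacian x H u - (2 * dotv (H u) (H u)) *: H u
    + \sum_(i < 2) \sum_(j < 2) dotv (H u) (alpha i j) *: alpha i j = 0.

Definition s_willmore (R : realType) (M : surface R) (n : nat)
    (f : M -> 'rV[R]_n) : Prop :=
  forall c : chart R M, atlas c ->
  let x := f \o chart_inv c in
  isothermal x (chart_img c) ->
  let Omega := complexify (second_ff x) (@d_z R) (@d_z R) in
  forall u, chart_img c u ->
  exists mu : R[i],
    complexify (normal_conn x) (@d_zbar R) Omega u = mu *: Omega u.

(* Main.v *)
Require Import Defs.
From HB Require Import structures.
From mathcomp Require Import all_boot all_order all_algebra.
From mathcomp Require Import all_classical all_reals all_analysis.
From mathcomp Require Import complex.
From mathcomp Require Import ring lra.

(** Work in a chart in which the metric is E times the Euclidean one, z = u0 + i u1,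
    and write D for the normal connection.  Put

      2 Omega = A - i B,    Omega = alpha (d_z, d_z),

    with A = (alpha_00 - alpha_11) / 2 and B = alpha_01 real normal fields.  The
    curvature ellipse at a point is centred at H and spanned by A / E and B / E, so the
    surface is superconformal exactly when Omega is isotropic and does not vanish:
    |A| = |B|, <A, B> = 0, A <> 0 (superconformal_isothermal).

    Differentiating <Omega, Omega> = 0 along zbar gives <D_zbar Omega, Omega> = 0
    (dbar_isotropic), and a second time

      <D_zbar D_zbar Omega, Omega> + <D_zbar Omega, D_zbar Omega> = 0.

    The first term vanishes.  By the Codazzi equation D_zbar Omega = (E / 2) D_z H, so
    D_zbar D_zbar Omega is (E / 2) D_zbar D_z H up to a multiple of D_zbar Omega, which is
    orthogonal to Omega.  The real part of D_zbar D_z H is a Laplacian, known from the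
    Willmore equation; its imaginary part is the normal curvature applied to H, known
    from the Ricci equation (codazzi, ricci, willmore_isothermal).  Both are
    combinations of A and B with coefficients <H, A> and <H, B>, and as |A| = |B| and
    <A, B> = 0 the two contributions to the product with Omega cancel.  Hence
    D_zbar Omega is isotropic as well as orthogonal to Omega (dbar_square_isotropic).

    The normal spaces of a surface in R^5 have dimension three, and an isotropic
    subspace of C^3 has dimension at most one; so D_zbar Omega is a multiple of Omega.
    In real terms, if it were not, the two tangent vectors, A, B and the components of
    the real and imaginary parts of D_zbar Omega orthogonal to A and B would be six
    pairwise orthogonal nonzero vectors of R^5 (isotropic_parallel).

    The computation is carried out on real and imaginary parts: with
    P = D_0 A + D_1 B and Q = D_1 A - D_0 B one has 4 D_zbar Omega = P + i Q.  Vector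
    identities between normal fields are obtained by testing against normal fields,
    which reduces them to the Leibniz rule for scalar products.  Since smoothness
    speaks of iterated coordinate derivatives only, the symmetry of mixed derivatives
    (schwarz) and the linearity of directional derivatives (is_derive_smooth) are
    derived first, from the mean value theorem. *)

Set Implicit Arguments.
Unset Strict Implicit.
Unset Printing Implicit Defensive.
Import Order.TTheory GRing.Theory Num.Theory.
Import numFieldNormedType.Exports.
Local Open Scope classical_set_scope.
Local Open Scope ring_scope.

(** * Difference quotients and second derivatives in two variables *)

Section Line.
Variables (R : realType) (V : normedModType R).
Implicit Types (g : V -> R) (p v : V).

Lemma is_derive_line g p v (t : R) :
  derivable g (p + t *: v) v ->
  is_derive t 1 (fun s : R => g (p + s *: v)) ('D_v g (p + t *: v)).
Proof.
have E : (fun h : R => h^-1 *: (((fun s : R => g (p + s *: v)) \o shift t) (h *: 1)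
            - g (p + t *: v))) =
         (fun h : R => h^-1 *: ((g \o shift (p + t *: v)) (h *: v)
            - g (p + t *: v))).
  apply/funext => h /=; congr (_ *: (g _ - _)).
  by rewrite scalerDl addrCA; congr (_ + _); rewrite /GRing.scale /= mulr1.
by move=> dg; split; rewrite /derivable /derive E.
Qed.

(** The bounds are on absolute values because the increment h may be negative. *)
Lemma mvt_line g p v (h : R) :
  (forall t : R, `|t| <= `|h| -> derivable g (p + t *: v) v) ->
  exists2 t : R, `|t| <= `|h| &
    g (p + h *: v) - g p = h * 'D_v g (p + t *: v).
Proof.
move=> dg; pose G s : R := g (p + s *: v).
have dG (t : R) : `|t| <= `|h| -> is_derive t 1 G ('D_v g (p + t *: v)).
  by move=> /dg; exact: is_derive_line.
have cG (a b : R) : (forall t, t \in `[a, b] -> `|t| <= `|h|) ->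
    {within `[a, b], continuous G}.
  move=> ab; apply: derivable_within_continuous => t /ab /dG dGt.
  by apply: (@ex_derive _ _ _ t 1 G).
have G0 : g p = G 0 by rewrite /G scale0r addr0.
have [h0|h0] := leP 0 h.
- have ab (t : R) : t \in `[0, h] -> `|t| <= `|h|.
    by rewrite in_itv /= => /andP[t0 th]; rewrite !ger0_norm.
  have [t ht E] := @MVT_segment R G (fun t => 'D_v g (p + t *: v)) 0 h h0
    (fun t ht => dG t (ab t (subset_itv_oo_cc ht))) (cG _ _ ab).
  exists t; first exact: ab.
  by rewrite G0 -/(G h) E subr0 mulrC.
- have ab (t : R) : t \in `[h, 0] -> `|t| <= `|h|.
    rewrite in_itv /= => /andP[t0 th].
    by rewrite ler0_norm // ltr0_norm // lerN2.
  have [t ht E] := @MVT_segment R G (fun t => 'D_v g (p + t *: v)) h 0 (ltW h0)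
    (fun t ht => dG t (ab t (subset_itv_oo_cc ht))) (cG _ _ ab).
  exists t; first exact: ab.
  by rewrite G0 -/(G h) -opprB E sub0r mulrN opprK mulrC.
Qed.

Lemma is_derive_translate g p v q :
  derivable g (p + q) v -> is_derive p v (fun w => g (w + q)) ('D_v g (p + q)).
Proof.
have E : (fun h : R => h^-1 *: (((fun w => g (w + q)) \o shift p) (h *: v)
            - g (p + q))) =
         (fun h : R => h^-1 *: ((g \o shift (p + q)) (h *: v) - g (p + q))).
  by apply/funext => h /=; rewrite addrA.
by move=> dg; split; rewrite /derivable /derive E.
Qed.

End Line.

Section Schwarz.
Variables (R : realType) (V : normedModType R).
Implicit Types (g : V -> R) (p v w : V).

(** The mean value theorem is applied to q |-> g (q + h w) - g q along v, then to
    the v-derivative of g along w.  The left-hand side is symmetric in v and w, which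
    is what forces mixed derivatives to agree. *)
Lemma second_difference g p v w (h : R) :
  (forall s t : R, `|s| <= `|h| -> `|t| <= `|h| ->
     derivable g (p + s *: v + t *: w) v /\
     derivable ('D_v g) (p + s *: v + t *: w) w) ->
  exists s t : R, [/\ `|s| <= `|h|, `|t| <= `|h| &
    g (p + h *: v + h *: w) - g (p + h *: v) - (g (p + h *: w) - g p)
    = h * (h * 'D_w ('D_v g) (p + s *: v + t *: w))].
Proof.
move=> dg; pose G q := g (q + h *: w) - g q.
have dG (s : R) : `|s| <= `|h| -> is_derive (p + s *: v) v G
    ('D_v g (p + s *: v + h *: w) - 'D_v g (p + s *: v)).
  move=> sh; have [d1 _] := dg _ _ sh (lexx _).
  have z0 : `|0 : R| <= `|h| by rewrite normr0.
  have [d0 _] := dg s 0 sh z0; rewrite scale0r addr0 in d0.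
  by apply: is_deriveB; [exact: is_derive_translate|exact: derivableP].
have [s sh E] := @mvt_line R V G p v h (fun s sh => @ex_derive _ _ _ _ _ _ _ (dG s sh)).
have [|t th E2] := @mvt_line R V ('D_v g) (p + s *: v) w h.
  by move=> t th; case: (dg s t sh th).
exists s, t; split => //.
move: E; rewrite /G => ->; congr (_ * _).
by rewrite (@derive_val _ _ _ _ _ _ _ (dG s sh)) E2.
Qed.

(** Uniform in s and t, so that it covers the intermediate points that the mean
    value theorem yields only after h has been chosen. *)
Lemma near_parallelogram (P : V -> Prop) p v w :
  (\forall q \near p, P q) ->
  \forall h \near (0 : R), forall s t : R,
    `|s| <= `|h| -> `|t| <= `|h| -> P (p + s *: v + t *: w).
Proof.
move=> /nbhs_ballP[e /= e0 Pe].
pose k := `|v| + `|w| + 1.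
have k0 : 0 < k by rewrite ltr_wpDl ?addr_ge0.
apply/nbhs_ballP; exists (e / k) => /=; first exact: divr_gt0.
move=> h; rewrite -ball_normE /= sub0r normrN ltr_pdivlMr // => hk s t sh th.
apply: Pe; rewrite -ball_normE /= opprD opprD !addrA subrr sub0r -opprD normrN.
apply: le_lt_trans hk; apply: le_trans (ler_normD _ _) _; rewrite !normrZ.
rewrite /k mulrDr mulr1 mulrDr -[leLHS]addr0 lerD // lerD //; exact: ler_wpM2r.
Qed.

(** By symmetry of the second difference, the two mixed derivatives share a value
    at points arbitrarily close to p; continuity does the rest. *)
Theorem schwarz g p v w :
  (\forall q \near p, [/\ derivable g q v, derivable g q w,
      derivable ('D_v g) q w & derivable ('D_w g) q v]) ->
  {for p, continuous ('D_w ('D_v g))} -> {for p, continuous ('D_v ('D_w g))} ->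
  'D_w ('D_v g) p = 'D_v ('D_w g) p.
Proof.
move=> dg c1 c2; apply/eqP; rewrite -subr_eq0 -normr_le0; apply/ler_addgt0Pl => e e0.
rewrite addr0.
have e20 : 0 < e / 2 by rewrite divr_gt0.
pose P q := [/\ derivable g q v, derivable g q w,
   derivable ('D_v g) q w & derivable ('D_w g) q v] /\
   (`|'D_w ('D_v g) p - 'D_w ('D_v g) q| <= e / 2 /\
    `|'D_v ('D_w g) p - 'D_v ('D_w g) q| <= e / 2).
have nP : \forall q \near p, P q.
  apply: filterI => //; apply: filterI.
    by move/cvgrPdist_le: c1; apply.
  by move/cvgrPdist_le: c2; apply.
have N := @near_parallelogram P p v w nP.
have N' := @near_parallelogram P p w v nP.
have [d /= d0 Hd] := (nbhs_ballP _ _).1 (filterI N N').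
have d20 : 0 < d / 2 by rewrite divr_gt0.
have [|H1 H2] := Hd (d / 2).
  rewrite -ball_normE /= sub0r normrN ger0_norm ?ltW // ltr_pdivrMr //.
  by rewrite ltr_pMr // ltr1n.
have [|s [t [sh th E1]]] := @second_difference g p v w (d / 2).
  by move=> s t sh th; have [[? ? ? ?] _] := H1 s t sh th.
have [|s' [t' [sh' th' E2]]] := @second_difference g p w v (d / 2).
  by move=> s' t' sh' th'; have [[? ? ? ?] _] := H2 s' t' sh' th'.
have EE : 'D_w ('D_v g) (p + s *: v + t *: w) =
          'D_v ('D_w g) (p + s' *: w + t' *: v).
  apply: (mulfI (lt0r_neq0 d20)); apply: (mulfI (lt0r_neq0 d20)).
  apply: etrans (esym E1) _; apply: etrans _ E2.
  rewrite [p + _ *: w + _ *: v]addrAC !opprB !addrA [LHS]addrAC [RHS]addrAC.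
  by congr (_ + _); exact: addrAC.
have [_ [A1 _]] := H1 s t sh th.
have [_ [_ A2]] := H2 s' t' sh' th'.
rewrite -EE in A2.
rewrite [e]splitr; apply: le_trans (lerD A1 A2).
rewrite [X in _ <= _ + X]distrC; apply: le_trans (ler_normD _ _).
by rewrite addrA subrK.
Qed.

End Schwarz.

Section Directional.
Variables (R : realType) (V : normedModType R).
Implicit Types (g : V -> R) (p v w : V).

Lemma is_derive_scale g p v (a : R) :
  derivable g p v -> is_derive p (a *: v) g (a * 'D_v g p).
Proof.
move=> dg; have [->|a0] := eqVneq a 0.
  by rewrite scale0r mul0r; exact: is_derive0.
have H : h^-1 *: ((g \o shift p) (h *: (a *: v)) - g p) @[h --> 0^'] --> a * 'D_v g p.
  have -> : (fun h : R => h^-1 *: ((g \o shift p) (h *: (a *: v)) - g p)) =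
     (fun h : R => a * (((h * a)^-1) *: ((g \o shift p) ((h * a) *: v) - g p))).
    apply/funext => h; rewrite scalerA /GRing.scale /= invfM mulrA [in RHS]mulrCA.
    by rewrite mulfV // mulr1.
  apply: cvgM; first exact: cvg_cst.
  have C : (fun h : R => h * a) @ 0^' --> 0^'.
    move=> P /nbhs_ballP[d /= d0 Pd]; apply/nbhs_ballP; exists (d / `|a|) => /=.
      by rewrite divr_gt0 // normr_gt0.
    move=> h; rewrite -ball_normE /= sub0r normrN ltr_pdivlMr ?normr_gt0 // => hd h0.
    apply: Pd; last exact: mulf_neq0.
    by rewrite -ball_normE /= sub0r normrN normrM.
  exact: (@cvg_comp _ _ _ _ (fun h : R => h^-1 *: ((g \o shift p) (h *: v) - g p))
    _ _ _ C dg).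
split; first by apply/cvg_ex; exists (a * 'D_v g p).
exact/cvg_lim.
Qed.

(** The increment along v + w is split at p + h v: its first part gives the
    v-derivative, and by the mean value theorem the second part is a w-derivative at a
    point that tends to p. *)
Lemma is_derive_add g p v w :
  (\forall q \near p, derivable g q w) -> {for p, continuous ('D_w g)} ->
  derivable g p v -> is_derive p (v + w) g ('D_v g p + 'D_w g p).
Proof.
move=> dw cw dv.
have H : h^-1 *: ((g \o shift p) (h *: (v + w)) - g p) @[h --> 0^']
    --> 'D_v g p + 'D_w g p.
  have -> : (fun h : R => h^-1 *: ((g \o shift p) (h *: (v + w)) - g p)) =
     (fun h : R => h^-1 *: ((g \o shift p) (h *: v) - g p) +
        h^-1 *: (g (p + h *: v + h *: w) - g (p + h *: v))).
    apply/funext => h; rewrite -scalerDr /=; congr (_ *: _).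
    rewrite [h *: _ + p]addrC scalerDr addrA [h *: v + p]addrC.
    by rewrite [RHS]addrC addrA subrK.
  apply: cvgD; first exact: dv.
  apply/cvgrPdist_le => e e0.
  pose P q := derivable g q w /\ `|'D_w g p - 'D_w g q| <= e.
  have nP : \forall q \near p, P q.
    by apply: filterI => //; move/cvgrPdist_le: cw; apply.
  have N := @near_parallelogram R V P p v w nP.
  near=> h.
  have h0 : h != 0 by near: h; exact: nbhs_dnbhs_neq.
  have Nh : forall s t : R, `|s| <= `|h| -> `|t| <= `|h| -> P (p + s *: v + t *: w).
    by near: h; exact: nbhs_dnbhs.
  have [|t th ->] := @mvt_line R V g (p + h *: v) w h.
    by move=> t th; case: (Nh h t (lexx _) th).
  rewrite /GRing.scale /= mulKf //.
  by case: (Nh h t (lexx _) th).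
split; first by apply/cvg_ex; exists ('D_v g p + 'D_w g p).
exact/cvg_lim.
Unshelve. all: by end_near. Qed.

End Directional.

(** * Smooth functions on an open subset of the plane *)

(** Locked, so that two partial derivatives are never compared through the limits
    that define them. *)
HB.lock Definition pd (R : realType) (V : normedModType R) (i : 'I_2)
    (g : 'rV[R]_2 -> V) : 'rV[R]_2 -> V := 'D_(basisv R i) g.

Lemma pdE (R : realType) (V : normedModType R) i (g : 'rV[R]_2 -> V) :
  pd i g = 'D_(basisv R i) g.
Proof. by rewrite pd.unlock. Qed.

(** Recursion on the order makes closure under products and inverses an induction:
    the Leibniz rule expresses a derivative through functions of one order less. *)
Fixpoint Ck (R : realType) (U : set 'rV[R]_2) (k : nat) (g : 'rV[R]_2 -> R) : Prop :=
  (forall u, U u -> {for u, continuous g}) /\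
  match k with
  | 0 => True
  | k'.+1 => forall i, (forall u, U u -> derivable g u (basisv R i)) /\
                       Ck U k' (pd i g)
  end.

Definition smooth (R : realType) (U : set 'rV[R]_2) (g : 'rV[R]_2 -> R) : Prop :=
  forall k, Ck U k g.

Section ScalarCalculus.
Variables (R : realType) (U : set 'rV[R]_2).
Hypothesis openU : open U.
Implicit Types (f g : 'rV[R]_2 -> R) (i j : 'I_2).

Lemma near_open (P : 'rV[R]_2 -> Prop) u :
  U u -> (forall w, U w -> P w) -> \forall w \near u, P w.
Proof.
move=> Uu UP; have : nbhs u U by apply: open_nbhs_nbhs.
by apply: filterS.
Qed.

Lemma pd_ext (V : normedModType R) (f g : 'rV[R]_2 -> V) i u :
  (forall w, U w -> f w = g w) -> U u -> pd i f u = pd i g u.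
Proof. by move=> fg Uu; rewrite !pdE; apply: near_eq_derive; exact: near_open. Qed.

Lemma continuous_ext f g u : (forall w, U w -> f w = g w) -> U u ->
  {for u, continuous f} -> {for u, continuous g}.
Proof.
move=> fg Uu cf; rewrite /prop_for /continuous_at -(fg u Uu).
have N : \forall w \near u, f w = g w by exact: near_open.
exact: cvg_trans (near_eq_cvg N) cf.
Qed.

(** Stated for functions that agree on U only: the formulas available for
    geometric quantities hold on the chart and nowhere else. *)
Lemma Ck_ext k f g : (forall u, U u -> f u = g u) -> Ck U k f -> Ck U k g.
Proof.
elim: k f g => [|k IH] f g fg [cf df].
  all: have cg u : U u -> {for u, continuous g} by
    move=> Uu; apply: (continuous_ext fg Uu); exact: cf.
- by split.
- split=> // i; have [d c] := df i; split.
    by move=> u Uu; apply: near_eq_derivable (d u Uu); exact: near_open.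
  by apply: IH c => u Uu; exact: pd_ext.
Qed.

Lemma Ck_cont k g u : Ck U k g -> U u -> {for u, continuous g}.
Proof. by case: k => [|k] [c _]; exact: c. Qed.

Lemma Ck_derivable k g i u : Ck U k.+1 g -> U u -> derivable g u (basisv R i).
Proof. by move=> [_ /(_ i)[+ _]]; exact. Qed.

Lemma Ck_pd k g i : Ck U k.+1 g -> Ck U k (pd i g).
Proof. by move=> [_ /(_ i)[]]. Qed.

Lemma CkW k g : Ck U k.+1 g -> Ck U k g.
Proof.
elim: k g => [|k IH] g gs;
  (split; first by move=> u Uu; exact: (Ck_cont gs Uu)); first by [].
by move=> i; split; [move=> u Uu; exact: (Ck_derivable gs Uu)|apply/IH; exact: Ck_pd].
Qed.

Lemma Ck_cst k (a : R) : Ck U k (cst a).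
Proof.
elim: k a => [|k IH] a; split => //; try by move=> u Uu; exact: cst_continuous.
move=> i; split; first by move=> u Uu; exact: derivable_cst.
by apply: Ck_ext (IH 0) => u _; rewrite !pdE derive_cst.
Qed.

Lemma CkD k f g : Ck U k f -> Ck U k g -> Ck U k (fun u => f u + g u).
Proof.
elim: k f g => [|k IH] f g fs gs; (split; first by
  move=> u Uu; apply: continuousD; [exact: Ck_cont fs Uu|exact: Ck_cont gs Uu]).
  by [].
move=> i; split.
  by move=> u Uu; apply: derivableD;
     [exact: (Ck_derivable fs Uu)|exact: (Ck_derivable gs Uu)].
apply: (@Ck_ext _ (fun u => pd i f u + pd i g u)); last by apply: IH; exact: Ck_pd.
by move=> u Uu; rewrite !pdE -deriveD //;
   [exact: (Ck_derivable fs Uu)|exact: (Ck_derivable gs Uu)].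
Qed.

Lemma CkM k f g : Ck U k f -> Ck U k g -> Ck U k (fun u => f u * g u).
Proof.
elim: k f g => [|k IH] f g fs gs; (split; first by
  move=> u Uu; apply: continuousM; [exact: Ck_cont fs Uu|exact: Ck_cont gs Uu]).
  by [].
move=> i; split.
  by move=> u Uu; apply: derivableM;
     [exact: (Ck_derivable fs Uu)|exact: (Ck_derivable gs Uu)].
apply: (@Ck_ext _ (fun u => f u * pd i g u + g u * pd i f u)).
  by move=> u Uu; rewrite !pdE -[LHS]deriveM //;
     [exact: (Ck_derivable fs Uu)|exact: (Ck_derivable gs Uu)].
by apply: CkD; apply: IH; try exact: CkW; exact: Ck_pd.
Qed.

Lemma CkV k g : (forall u, U u -> g u != 0) -> Ck U k g ->
  Ck U k (fun u => (g u)^-1).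
Proof.
move=> g0; elim: k => [|k IH] gs; (split; first by
  move=> u Uu; apply: continuousV; [exact: g0|exact: Ck_cont gs Uu]).
  by [].
move=> i; split.
  by move=> u Uu; apply: derivableV; [exact: g0|exact: (Ck_derivable gs Uu)].
have gk := IH (CkW gs).
apply: (@Ck_ext _ (fun u => -1 * ((g u)^-1 * (g u)^-1 * pd i g u))).
  move=> u Uu; rewrite !pdE [RHS]deriveV ?g0 //; last exact: (Ck_derivable gs Uu).
  by rewrite mulN1r /GRing.scale /= mulNr expr2 -invfM.
apply: CkM; first exact: (Ck_cst k (-1)).
by apply: CkM; [exact: CkM|exact: Ck_pd].
Qed.

Lemma smooth_ext f g : (forall u, U u -> f u = g u) -> smooth U f -> smooth U g.
Proof. by move=> fg fs k; apply: Ck_ext fg _. Qed.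

Lemma smooth_cont g u : smooth U g -> U u -> {for u, continuous g}.
Proof. by move=> /(_ 0); exact: Ck_cont. Qed.

Lemma smooth_derivable g i u : smooth U g -> U u -> derivable g u (basisv R i).
Proof. by move=> /(_ 1); exact: Ck_derivable. Qed.

Lemma smooth_pd g i : smooth U g -> smooth U (pd i g).
Proof. by move=> gs k; exact: (Ck_pd i (gs k.+1)). Qed.

Lemma smooth_cst (a : R) : smooth U (cst a).
Proof. by move=> k; exact: Ck_cst. Qed.

Lemma smoothD f g : smooth U f -> smooth U g -> smooth U (fun u => f u + g u).
Proof. by move=> fs gs k; exact: CkD. Qed.

Lemma smoothM f g : smooth U f -> smooth U g -> smooth U (fun u => f u * g u).
Proof. by move=> fs gs k; exact: CkM. Qed.

Lemma smoothV g : (forall u, U u -> g u != 0) -> smooth U g ->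
  smooth U (fun u => (g u)^-1).
Proof. by move=> g0 gs k; exact: CkV. Qed.

Lemma smooth_sum n (F : 'I_n -> 'rV[R]_2 -> R) :
  (forall k, smooth U (F k)) -> smooth U (fun u => \sum_(k < n) F k u).
Proof.
elim: n F => [|n IH] F Fs.
  by apply: smooth_ext (smooth_cst 0) => u _; rewrite big_ord0.
apply: (@smooth_ext (fun u => F ord0 u + \sum_(k < n) F (lift ord0 k) u)).
  by move=> u _; rewrite big_ord_recl.
by apply: smoothD => //; exact: IH.
Qed.

Lemma pdM f g i u : smooth U f -> smooth U g -> U u ->
  pd i (fun w => f w * g w) u = f u * pd i g u + g u * pd i f u.
Proof.
by move=> fs gs Uu; rewrite !pdE [LHS]deriveM //; exact: smooth_derivable.
Qed.

Lemma pdC g i j u : smooth U g -> U u -> pd i (pd j g) u = pd j (pd i g) u.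
Proof.
move=> gs Uu; rewrite !pdE; apply: schwarz; rewrite -!pdE;
  try by apply: smooth_cont => //; do 2 apply: smooth_pd.
apply: near_open => // w Uw.
by split; apply: smooth_derivable => //; exact: smooth_pd.
Qed.

(** Smoothness speaks of coordinate directions only; this recovers every
    direction, and with it the chain rule for arbitrary tangent vectors. *)
Lemma is_derive_smooth g (X : 'rV[R]_2) u : smooth U g -> U u ->
  is_derive u X g (X 0 0 * pd 0 g u + X 0 1 * pd 1 g u).
Proof.
move=> gs Uu.
have -> : X = X 0 0 *: basisv R 0 + X 0 1 *: basisv R 1.
  apply/rowP => k; rewrite !mxE /=.
  by case: k => [[|[|//]] hk]; rewrite /= ?mulr1 ?mulr0 ?addr0 ?add0r;
     congr (X _ _); apply: val_inj.
rewrite !mxE /= !(mulr0, mulr1, addr0, add0r).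
have E a w : U w -> 'D_(a *: basisv R 1) g w = a * pd 1 g w.
  move=> Uw; rewrite pdE; have dg := @smooth_derivable g 1 w gs Uw.
  exact: (@derive_val _ _ _ _ _ _ _ (is_derive_scale a dg)).
have dg0 := is_derive_scale (X 0 0) (@smooth_derivable g 0 u gs Uu).
rewrite -(E _ u Uu) [pd 0 g]pdE -(@derive_val _ _ _ _ _ _ _ dg0).
apply: is_derive_add.
- apply: near_open => // w Uw.
  exact: (@ex_derive _ _ _ _ _ _ _ (is_derive_scale _ (@smooth_derivable g 1 w gs Uw))).
- have : {for u, continuous (fun w => X 0 1 * pd 1 g w)}.
    apply: continuousM; first exact: cst_continuous.
    by apply: smooth_cont => //; exact: smooth_pd.
  by apply: continuous_ext Uu => w Uw; rewrite E.
- exact: (@ex_derive _ _ _ _ _ _ _ dg0).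
Qed.

End ScalarCalculus.

(** * Scalar products and smooth vector-valued maps *)

Section Dot.
Variables (R : realType) (n : nat).
Implicit Types (u v w : 'rV[R]_n) (a : R).

Lemma dotvC v w : dotv v w = dotv w v.
Proof. by apply: eq_bigr => k _; rewrite mulrC. Qed.

Lemma dotvDl u v w : dotv (u + v) w = dotv u w + dotv v w.
Proof. by rewrite -big_split; apply: eq_bigr => k _; rewrite !mxE mulrDl. Qed.

Lemma dotvZl a v w : dotv (a *: v) w = a * dotv v w.
Proof. by rewrite mulr_sumr; apply: eq_bigr => k _; rewrite !mxE mulrA. Qed.

Lemma dotvDr u v w : dotv w (u + v) = dotv w u + dotv w v.
Proof. by rewrite dotvC dotvDl ![dotv _ w]dotvC. Qed.

Lemma dotvZr a v w : dotv v (a *: w) = a * dotv v w.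
Proof. by rewrite dotvC dotvZl dotvC. Qed.

Lemma dotvNl v w : dotv (- v) w = - dotv v w.
Proof. by rewrite -scaleN1r dotvZl mulN1r. Qed.

Lemma dotvNr v w : dotv v (- w) = - dotv v w.
Proof. by rewrite dotvC dotvNl dotvC. Qed.

Lemma dot0v v : dotv 0 v = 0.
Proof. by rewrite -(scale0r 0) dotvZl mul0r. Qed.

Lemma dotv0 v : dotv v 0 = 0.
Proof. by rewrite dotvC dot0v. Qed.

Lemma dotv_eq0 v : dotv v v = 0 -> v = 0.
Proof.
move=> /eqP; rewrite psumr_eq0; last by move=> k _; rewrite -expr2 sqr_ge0.
move=> /allP v0; apply/rowP => k; rewrite mxE; apply/eqP.
by have := v0 k (mem_index_enum k); rewrite /= mulf_eq0 orbb.
Qed.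

Definition dotE := (dotvDl, dotvDr, dotvZl, dotvZr, dotvNl, dotvNr, dotv0, dot0v).

End Dot.

Definition vsmooth (R : realType) (n : nat) (U : set 'rV[R]_2)
    (v : 'rV[R]_2 -> 'rV[R]_n) : Prop :=
  forall j, smooth U (fun u => v u 0 j).

Section VectorCalculus.
Variables (R : realType) (n : nat) (U : set 'rV[R]_2).
Hypothesis openU : open U.
Implicit Types (f g : 'rV[R]_2 -> R) (v w : 'rV[R]_2 -> 'rV[R]_n) (i : 'I_2).

Lemma vsmooth_derivable v X u : vsmooth U v -> U u -> derivable v u X.
Proof.
move=> vs Uu; apply/derivable_mxP => i j; rewrite ord1.
exact: (@ex_derive _ _ _ _ _ _ _ (is_derive_smooth openU X (vs j) Uu)).
Qed.

Lemma pd_coord v i u j : vsmooth U v -> U u ->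
  pd i v u 0 j = pd i (fun t => v t 0 j) u.
Proof.
by move=> vs Uu; rewrite !pdE derive_mx ?mxE //; exact: vsmooth_derivable.
Qed.

Lemma derive_vsmooth v (X : 'rV[R]_2) u : vsmooth U v -> U u ->
  'D_X v u = X 0 0 *: pd 0 v u + X 0 1 *: pd 1 v u.
Proof.
move=> vs Uu; apply/rowP => j.
have [E0 E1] := (pd_coord 0 j vs Uu, pd_coord 1 j vs Uu).
rewrite derive_mx; last exact: vsmooth_derivable.
rewrite [LHS]mxE; move: (pd 0 v u) (pd 1 v u) E0 E1 => a b E0 E1.
rewrite !mxE E0 E1.
exact: (@derive_val _ _ _ _ _ _ _ (is_derive_smooth openU X (vs j) Uu)).
Qed.

Lemma vsmooth_ext v w : (forall u, U u -> v u = w u) -> vsmooth U v -> vsmooth U w.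
Proof. by move=> vw vs j; apply: smooth_ext (vs j) => // u Uu; rewrite vw. Qed.

Lemma vsmooth_pd v i : vsmooth U v -> vsmooth U (pd i v).
Proof.
move=> vs j; apply: (smooth_ext openU) (smooth_pd i (vs j)) => u Uu.
by rewrite pd_coord.
Qed.

Lemma vsmoothD v w : vsmooth U v -> vsmooth U w -> vsmooth U (fun u => v u + w u).
Proof.
move=> vs ws j; apply: (smooth_ext openU) (smoothD openU (vs j) (ws j)) => u _.
by rewrite mxE.
Qed.

Lemma vsmoothZ f v : smooth U f -> vsmooth U v -> vsmooth U (fun u => f u *: v u).
Proof.
move=> fs vs j; apply: (smooth_ext openU) (smoothM openU fs (vs j)) => u _.
by rewrite mxE.
Qed.

Lemma vsmoothB v w : vsmooth U v -> vsmooth U w -> vsmooth U (fun u => v u - w u).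
Proof.
move=> vs ws; apply: vsmooth_ext (vsmoothD vs (vsmoothZ (smooth_cst openU (-1)) ws)).
by move=> u _; rewrite scaleN1r.
Qed.

Lemma smooth_dot v w : vsmooth U v -> vsmooth U w ->
  smooth U (fun u => dotv (v u) (w u)).
Proof. by move=> vs ws; apply: smooth_sum => // k; exact: smoothM. Qed.

Lemma pd_dot v w i u : vsmooth U v -> vsmooth U w -> U u ->
  pd i (fun u => dotv (v u) (w u)) u = dotv (pd i v u) (w u) + dotv (v u) (pd i w u).
Proof.
move=> vs ws Uu.
have -> : (fun u => dotv (v u) (w u)) = \sum_(k < n) (fun u => v u 0 k * w u 0 k).
  by apply/funext => t; rewrite fct_sumE.
transitivity (\sum_(k < n) pd i (fun u => v u 0 k * w u 0 k) u).
  rewrite pdE derive_sum; first by apply: eq_bigr => k _; rewrite pdE.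
  by move=> k; apply: (@smooth_derivable _ U) => //; exact: smoothM.
rewrite -big_split; apply: eq_bigr => k _ /=.
rewrite (@pdM _ U) // pd_coord // pd_coord // addrC.
by congr (_ + _); rewrite mulrC.
Qed.

Lemma pd_vectorC v i j u : vsmooth U v -> U u -> pd i (pd j v) u = pd j (pd i v) u.
Proof.
move=> vs Uu; apply/rowP => k.
have E i' j' : pd i' (pd j' v) u 0 k = pd i' (pd j' (fun t => v t 0 k)) u.
  rewrite pd_coord //; last exact: vsmooth_pd.
  by apply: (pd_ext openU) => // t Ut; rewrite pd_coord.
exact: etrans (E i j) (etrans (pdC openU i j (vs k) Uu) (esym (E j i))).
Qed.

Lemma pd_vectorD v w i u : vsmooth U v -> vsmooth U w -> U u ->
  pd i (fun u => v u + w u) u = pd i v u + pd i w u.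
Proof. by move=> vs ws Uu; rewrite !pdE; apply: deriveD; exact: vsmooth_derivable. Qed.

Lemma pd_vectorB v w i u : vsmooth U v -> vsmooth U w -> U u ->
  pd i (fun u => v u - w u) u = pd i v u - pd i w u.
Proof. by move=> vs ws Uu; rewrite !pdE; apply: deriveB; exact: vsmooth_derivable. Qed.

Lemma pd_vectorZ_cst a v i u : vsmooth U v -> U u ->
  pd i (fun u => a *: v u) u = a *: pd i v u.
Proof. by move=> vs Uu; rewrite !pdE; apply: deriveZ; exact: vsmooth_derivable. Qed.

Lemma pd_vectorZ f v i u : smooth U f -> vsmooth U v -> U u ->
  pd i (fun u => f u *: v u) u = pd i f u *: v u + f u *: pd i v u.
Proof.
move=> fs vs Uu; apply/rowP => k.
rewrite pd_coord //; last exact: vsmoothZ.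
have E := pd_coord i k vs Uu; move: (pd i v u) E => p E.
rewrite !mxE E addrC [X in _ + X]mulrC -(@pdM _ U) //.
by apply: (pd_ext openU) => // t _; rewrite mxE.
Qed.

Lemma vsmooth_smooth_on v : smooth_on U v -> vsmooth U v.
Proof.
move=> vs j k.
have c s u : U u -> {for u, continuous (fun u => iter_partial s v u 0 j)}.
  move=> Uu; have [c _] := vs s u Uu.
  apply: (@continuous_comp _ _ _ (iter_partial s v) (fun M : 'rV[R]_n => M 0 j) u c).
  exact: coord_continuous.
have : forall s, Ck U k (fun u => iter_partial s v u 0 j).
  elim: k => [|k IH] s; (split; first by move=> u; exact: c) => // i; split.
    by move=> u Uu; have [_ /(_ i)/derivable_mxP] := vs s u Uu; apply.
  apply: (Ck_ext openU) (IH (i :: s)) => u Uu.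
  by rewrite /= !pdE derive_mx ?mxE //; have [_] := vs s u Uu.
by move=> /(_ [::]).
Qed.

End VectorCalculus.

(** * Orthogonality and circles in Euclidean space *)

(** The Gram matrix is diagonal with nonzero entries, hence of rank the number of
    vectors, and its rank is at most n. *)
Lemma orthogonal_size (R : realType) n (s : seq 'rV[R]_n) :
  pairwise (fun v w => dotv v w == 0) s -> all (fun v => v != 0) s ->
  (size s <= n)%N.
Proof.
move=> /(pairwiseP 0) orth /(all_nthP 0) nz.
pose M := \matrix_(i < size s) nth 0 s i.
pose d := \row_(i < size s) dotv (nth 0 s i) (nth 0 s i).
have MM : M *m M^T = diag_mx d.
  apply/matrixP => i j; rewrite !mxE.
  transitivity (dotv (nth 0 s i) (nth 0 s j)).
    by apply: eq_bigr => k _; rewrite !mxE.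
  have [->|ij] := eqVneq i j; first by rewrite mulr1n.
  rewrite mulr0n; move: ij; rewrite neq_ltn => /orP[ij|ij].
    by apply/eqP/orth => //; rewrite inE.
  by rewrite dotvC; apply/eqP/orth => //; rewrite inE.
have U : M *m M^T \in unitmx.
  rewrite MM unitmxE det_diag unitfE prodf_seq_neq0; apply/allP => i _ /=.
  by rewrite mxE; apply: contra_neq (nz i (ltn_ord i)); exact: dotv_eq0.
rewrite -(mxrank_unit U); exact: leq_trans (mxrankM_maxl _ _) (rank_leq_col _).
Qed.

(** The conclusion says that p + i q = (r + i s) (a - i b).  Here t0 and t1 are
    tangent vectors, and a - i b and p + i q span an isotropic space in the
    complexified normal space, of dimension at most 3. *)
Lemma isotropic_parallel (R : realType) n (t0 t1 a b p q : 'rV[R]_n) :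
  (n <= 5)%N ->
  t0 != 0 -> t1 != 0 -> dotv t0 t1 = 0 ->
  (forall v, v \in [:: a; b; p; q] -> dotv t0 v = 0 /\ dotv t1 v = 0) ->
  a != 0 -> dotv a a = dotv b b -> dotv a b = 0 ->
  dotv p p = dotv q q -> dotv p q = 0 ->
  dotv p a + dotv q b = 0 -> dotv q a - dotv p b = 0 ->
  exists r s : R, p = r *: a + s *: b /\ q = s *: a - r *: b.
Proof.
move=> n5 t00 t10 t01 tn a0 ab orth pq pqo e1 e2.
have m0 : dotv a a != 0 by apply: contra_neq a0; exact: dotv_eq0.
have b0 : b != 0 by apply: contra_neq m0; rewrite ab => ->; rewrite dotv0.
(* p' and q' below are the components orthogonal to a and b; they inherit equal norms
   and orthogonality from p and q *)
pose r := dotv p a / dotv a a; pose s := dotv p b / dotv a a.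
have pa : dotv p a = r * dotv a a by rewrite divfK.
have pb : dotv p b = s * dotv a a by rewrite divfK.
have qa : dotv q a = s * dotv a a by rewrite -pb; lra.
have qb : dotv q b = - (r * dotv a a) by rewrite -pa; lra.
have [[a0' a1'] [b0' b1'] [p0' p1'] [q0' q1']] : [/\ dotv t0 a = 0 /\ dotv t1 a = 0,
   dotv t0 b = 0 /\ dotv t1 b = 0, dotv t0 p = 0 /\ dotv t1 p = 0
   & dotv t0 q = 0 /\ dotv t1 q = 0].
  by split; apply: tn; rewrite !inE eqxx ?orbT.
pose p' := p - (r *: a + s *: b); pose q' := q - (s *: a - r *: b).
have pp : dotv p' p' = dotv q' q'.
  rewrite /p' /q' !dotE ![dotv a p]dotvC ![dotv a q]dotvC ![dotv b p]dotvC
    ![dotv b q]dotvC ![dotv b a]dotvC pa pb qa qb orth -ab pq; ring.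
have pq' : dotv p' q' = 0.
  rewrite /p' /q' !dotE ![dotv a q]dotvC ![dotv b q]dotvC ![dotv b a]dotvC
    pa pb qa qb orth -ab pqo; ring.
have p'0 : p' = 0.
  apply/eqP; apply: contraT => np.
  have nq : q' != 0.
    apply: contra_neq np => q0; apply: dotv_eq0; by rewrite pp q0 dotv0.
  suff : (size [:: t0; t1; a; b; p'; q'] <= n)%N by rewrite leqNgt ltnS n5.
  apply: orthogonal_size; last by rewrite /= t00 t10 a0 b0 np nq.
  have E := (t01, a0', a1', b0', b1', orth, pq').
  rewrite /= !E !eqxx /= andbT /p' /q' !dotE !(p0', p1', q0', q1', E).
  rewrite [dotv a p]dotvC [dotv b p]dotvC [dotv a q]dotvC [dotv b q]dotvC.
  rewrite [dotv b a]dotvC orth pa pb qa qb -ab.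
  rewrite !(mulr0, addr0, subr0, oppr0, add0r, mulrN, opprK).
  by rewrite ?subrr ?addNr ?eqxx.
exists r, s; split; first by apply/eqP; rewrite -subr_eq0 -/p' p'0.
apply/eqP; rewrite -subr_eq0 -/q'; apply/eqP/dotv_eq0.
by rewrite -pp p'0 dotv0.
Qed.

(** With c = cos t and s = sin t, the set is the ellipse
    h + cos (2t) a + sin (2t) b.  Its points are at a fixed distance of the centre of
    the circle; this is linear in the scalar products of a, b and the difference of
    the two centres, so finitely many points determine them. *)
Lemma circle_conformal (R : realType) n (h a b : 'rV[R]_n) (S : set 'rV[R]_n) :
  (forall y, S y <-> exists c s : R, c ^+ 2 + s ^+ 2 = 1 /\
      y = h + (c ^+ 2 - s ^+ 2) *: a + (2 * c * s) *: b) ->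
  nondegenerate_circle S ->
  [/\ a != 0, dotv a a = dotv b b & dotv a b = 0].
Proof.
move=> SE [z [e1 [e2 [r [r0 e11 e22 e12 Sc]]]]].
pose d := h - z.
have F (c s : R) : c ^+ 2 + s ^+ 2 = 1 ->
    let al := c ^+ 2 - s ^+ 2 in let be := 2 * c * s in
    dotv d d + al ^+ 2 * dotv a a + be ^+ 2 * dotv b b
    + 2 * al * dotv d a + 2 * be * dotv d b + 2 * al * be * dotv a b = r ^+ 2.
  move=> cs al be.
  have : S (h + al *: a + be *: b) by apply/SE; exists c, s.
  rewrite Sc => -[t _ tE].
  have dE : d + al *: a + be *: b = (r * cos t) *: e1 + (r * sin t) *: e2.
    have -> : d + al *: a + be *: b = h + al *: a + be *: b - z.
      by rewrite /d -!addrA; congr (_ + _); rewrite addrC -addrA.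
    by rewrite -tE -[z + _ + _]addrA addrAC subrr add0r.
  clearbody d.
  have : dotv (d + al *: a + be *: b) (d + al *: a + be *: b) = r ^+ 2.
    rewrite dE !dotE [dotv e2 e1]dotvC e11 e22 e12.
    transitivity (r ^+ 2 * (cos t ^+ 2 + sin t ^+ 2)); first ring.
    by rewrite cos2Dsin2 mulr1.
  move=> <-; rewrite !dotE [dotv a d]dotvC [dotv b d]dotvC [dotv b a]dotvC; ring.
(* t = 0, t = pi / 2, and angles of the triangle 3, 4, 5, which realise all four sign
   patterns of (cos (2t), sin (2t)) with rational coordinates *)
have F1 := F 1 0 ltac:(lra). have F2 := F 0 1 ltac:(lra).
have F3 := F (3 / 5) (4 / 5) ltac:(lra).
have F4 := F (4 / 5) (- 3 / 5) ltac:(lra).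
have F5 := F (3 / 5) (- 4 / 5) ltac:(lra).
have F6 := F (4 / 5) (3 / 5) ltac:(lra).
move: F1 F2 F3 F4 F5 F6 => /= F1 F2 F3 F4 F5 F6.
have ab : dotv a a = dotv b b by lra.
have orth : dotv a b = 0 by lra.
split=> //; apply/eqP => a0.
have b0 : b = 0 by apply: dotv_eq0; rewrite -ab a0 dotv0.
have Sh y : S y -> y = h.
  by move=> /SE[c [s [_ ->]]]; rewrite a0 b0 !scaler0 !addr0.
(* a = b = 0 would reduce the circle to one point, but it has antipodal ones *)
have S1 : S (z + r *: e1).
  rewrite Sc; exists 0 => //; by rewrite cos0 sin0 mulr0 mulr1 scale0r addr0.
have S2 : S (z - r *: e1).
  rewrite Sc; exists pi => //.
  by rewrite cospi sinpi mulr0 scale0r addr0 mulrN1 scaleNr.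
have : z + r *: e1 = z - r *: e1 by rewrite (Sh _ S1) (Sh _ S2).
move/addrI => re; have : dotv (r *: e1) e1 = dotv (- (r *: e1)) e1 by rewrite -re.
rewrite dotvNl dotvZl e11; lra.
Qed.

(** * Normal fields along a surface in isothermal coordinates *)

Lemma pd_at (R : realType) (V : normedModType R) i (g : 'rV[R]_2 -> V) u :
  'D_(basisv R i) g u = pd i g u.
Proof. by rewrite pdE. Qed.

Lemma ord2_cases (k : 'I_2) : k = 0 \/ k = 1.
Proof. by case: k => [[|[|//]] hk]; [left|right]; apply: val_inj. Qed.

Lemma sum_ord2 (V : nmodType) (F : 'I_2 -> V) : \sum_(i < 2) F i = F 0 + F 1.
Proof.
rewrite big_ord_recl big_ord1 /=; congr (F _ + F _); exact: val_inj.
Qed.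

Lemma sum_scalar2 (R : realType) n (a : R) (c : 'I_2 -> R) (y : 'I_2 -> 'rV[R]_n) :
  \sum_(i < 2) \sum_(j < 2) ((a%:M : 'M[R]_2) i j * c j) *: y i =
  a *: (c 0 *: y 0 + c 1 *: y 1).
Proof.
rewrite !sum_ord2 !mxE /= !mulr1n !mulr0n !mul0r !scale0r addr0 add0r.
by rewrite scalerDr !scalerA.
Qed.

Definition conformal_factor (R : realType) n (x : 'rV[R]_2 -> 'rV[R]_n) u : R :=
  dotv (pd 0 x u) (pd 0 x u).

Definition pd2 (R : realType) n i j (x : 'rV[R]_2 -> 'rV[R]_n) := pd i (pd j x).

HB.lock Definition normal_proj (R : realType) n (x v : 'rV[R]_2 -> 'rV[R]_n)
  : 'rV[R]_2 -> 'rV[R]_n := fun u => normal_part x u (v u).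

(** The normal connection along the i-th coordinate field. *)
Definition normal_pd (R : realType) n (x : 'rV[R]_2 -> 'rV[R]_n) i v :=
  normal_proj x (pd i v).

(** With sff_off, the real normal fields A and B such that
    2 alpha (d_z, d_z) = A - i B. *)
Definition sff_diag (R : realType) n (x : 'rV[R]_2 -> 'rV[R]_n) :=
  normal_proj x (fun u => 2^-1 *: (pd2 0 0 x u - pd2 1 1 x u)).

Definition sff_off (R : realType) n (x : 'rV[R]_2 -> 'rV[R]_n) :=
  normal_proj x (pd2 0 1 x).

(** The mean curvature vector times the conformal factor; see half_traceE. *)
Definition half_trace (R : realType) n (x : 'rV[R]_2 -> 'rV[R]_n) :=
  normal_proj x (fun u => 2^-1 *: (pd2 0 0 x u + pd2 1 1 x u)).

(** The mean curvature vector; see mean_curvatureE. *)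
HB.lock Definition iso_mean (R : realType) n (x : 'rV[R]_2 -> 'rV[R]_n)
  : 'rV[R]_2 -> 'rV[R]_n := fun u => (conformal_factor x u)^-1 *: half_trace x u.

Section Geometry.
Variables (R : realType) (n : nat) (U : set 'rV[R]_2) (x : 'rV[R]_2 -> 'rV[R]_n).
Hypothesis openU : open U.
Hypothesis xs : vsmooth U x.
Hypothesis iso : isothermal x U.
Implicit Types (v eta zeta : 'rV[R]_2 -> 'rV[R]_n) (i j k : 'I_2) (u : 'rV[R]_2).

Local Notation E := (conformal_factor x).
Local Notation xx i j := (pd2 i j x).
Local Notation nrm := (normal_proj x).
Local Notation Dn := (normal_pd x).
Local Notation A := (sff_diag x).
Local Notation B := (sff_off x).
Local Notation h := (half_trace x).
Local Notation H := (iso_mean x).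

Lemma normal_projE v u : nrm v u = normal_part x u (v u).
Proof. by rewrite normal_proj.unlock. Qed.

Lemma normal_pdE i v u : Dn i v u = normal_part x u (pd i v u).
Proof. exact: normal_projE. Qed.

Lemma iso_meanE u : H u = (E u)^-1 *: h u.
Proof. by rewrite iso_mean.unlock. Qed.

Lemma metric_isothermal u : U u -> metric x u = (E u)%:M.
Proof.
move=> /iso[l l0 ml].
have : metric x u 0 0 = l ^+ 2 by rewrite ml mxE eqxx.
by rewrite mxE pd_at -/(E u) => ->.
Qed.

Lemma conformal_factor_gt0 u : U u -> 0 < E u.
Proof.
move=> /iso[l l0 ml].
have : metric x u 0 0 = l ^+ 2 by rewrite ml mxE eqxx.
by rewrite mxE pd_at -/(E u) => ->; rewrite exprn_gt0.
Qed.

Lemma conformal_factor_neq0 u : U u -> E u != 0.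
Proof. by move=> /conformal_factor_gt0 /lt0r_neq0. Qed.

Lemma dot_tangent_frame i j u : U u -> dotv (pd i x u) (pd j x u) = E u *+ (i == j).
Proof.
move=> Uu; have : metric x u i j = E u *+ (i == j) by rewrite metric_isothermal // mxE.
by rewrite mxE !pd_at.
Qed.

Lemma vsmooth_pd_x i : vsmooth U (pd i x).
Proof. exact: vsmooth_pd. Qed.

Lemma vsmooth_pd2_x i j : vsmooth U (xx i j).
Proof. by apply: vsmooth_pd => //; exact: vsmooth_pd_x. Qed.
Hint Resolve vsmooth_pd_x vsmooth_pd2_x : core.

Lemma smooth_conformal_factor : smooth U E.
Proof. exact: smooth_dot. Qed.

Lemma smooth_conformal_factorV : smooth U (fun u => (E u)^-1).
Proof.
by apply: smoothV => //; [exact: conformal_factor_neq0|exact: smooth_conformal_factor].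
Qed.

Lemma pd2C i j u : U u -> xx i j u = xx j i u.
Proof. exact: pd_vectorC. Qed.

Lemma normal_partE u w : U u -> normal_part x u w =
  w - (E u)^-1 *: (dotv w (pd 0 x u) *: pd 0 x u + dotv w (pd 1 x u) *: pd 1 x u).
Proof.
move=> Uu; rewrite /normal_part metric_isothermal // invmx_scalar; congr (_ - _).
under eq_bigr do under eq_bigr do rewrite !pd_at.
exact: (sum_scalar2 _ (fun j => dotv w (pd j x u)) (fun i => pd i x u)).
Qed.

Definition normal_field v := vsmooth U v /\
  forall u, U u -> forall k, dotv (v u) (pd k x u) = 0.

Lemma normal_part_orth u w k : U u -> dotv (normal_part x u w) (pd k x u) = 0.
Proof.
move=> Uu; rewrite normal_partE // !dotE !dot_tangent_frame //.
have E0 := conformal_factor_neq0 Uu.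
have [->|->] := ord2_cases k; rewrite /= !(mulr1n, mulr0n, mulr0, addr0, add0r);
  by field.
Qed.

Lemma normal_part_dot u w z : U u -> (forall k, dotv z (pd k x u) = 0) ->
  dotv (normal_part x u w) z = dotv w z.
Proof.
move=> Uu z0; rewrite normal_partE // !dotE ![dotv (pd _ x u) z]dotvC !z0.
by rewrite !mulr0 addr0 mulr0 subr0.
Qed.

Lemma vsmooth_normal_proj v : vsmooth U v -> vsmooth U (nrm v).
Proof.
move=> vs.
pose w u := v u - (E u)^-1 *: (dotv (v u) (pd 0 x u) *: pd 0 x u
                             + dotv (v u) (pd 1 x u) *: pd 1 x u).
have ws : vsmooth U w.
  apply: vsmoothB => //; apply: vsmoothZ => //; first exact: smooth_conformal_factorV.
  by apply: vsmoothD => //; apply: vsmoothZ => //; apply: smooth_dot.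
by apply: (vsmooth_ext openU) ws => u Uu; rewrite normal_projE normal_partE.
Qed.

Lemma normal_proj_field v : vsmooth U v -> normal_field (nrm v).
Proof.
move=> vs; split; first exact: vsmooth_normal_proj.
by move=> u Uu k; rewrite normal_projE normal_part_orth.
Qed.

Lemma normal_pd_field i v : vsmooth U v -> normal_field (Dn i v).
Proof. by move=> vs; apply: normal_proj_field; exact: vsmooth_pd. Qed.

(** The Weingarten equation: <zeta, d_k x> vanishes identically. *)
Lemma dot_pd_normal zeta i k u : normal_field zeta -> U u ->
  dotv (pd i zeta u) (pd k x u) = - dotv (zeta u) (xx i k u).
Proof.
move=> [zs z0] Uu; apply/eqP; rewrite -addr_eq0; apply/eqP.
rewrite -(pd_dot openU i zs (vsmooth_pd_x k) Uu).
rewrite (@pd_ext _ _ openU _ _ (cst 0)) //; first by rewrite pdE derive_cst.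
by move=> t Ut; exact: z0.
Qed.

Lemma pd_dot_normal eta zeta i u : normal_field eta -> normal_field zeta -> U u ->
  pd i (fun u => dotv (eta u) (zeta u)) u =
  dotv (Dn i eta u) (zeta u) + dotv (eta u) (Dn i zeta u).
Proof.
move=> [es e0] [zs z0] Uu; rewrite (pd_dot openU) //; congr (_ + _).
  by rewrite normal_pdE normal_part_dot // => k; exact: z0.
by rewrite ![dotv (eta u) _]dotvC normal_pdE normal_part_dot // => k; exact: e0.
Qed.

(** The derivative of <nrm v, zeta> = <v, zeta> is computed in two ways; they
    differ by the scalar product of d_i zeta with the tangential part of v, which
    dot_pd_normal expresses through second derivatives of x. *)
Lemma normal_pd_proj v zeta i u : vsmooth U v -> normal_field zeta -> U u ->
  dotv (Dn i (nrm v) u) (zeta u) = dotv (pd i v u) (zeta u)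
    - (E u)^-1 * (dotv (v u) (pd 0 x u) * dotv (xx i 0 u) (zeta u)
                  + dotv (v u) (pd 1 x u) * dotv (xx i 1 u) (zeta u)).
Proof.
move=> vs zn Uu; have [zs z0] := zn; have ns := vsmooth_normal_proj vs.
rewrite normal_pdE normal_part_dot; [|by []|by move=> k; exact: z0].
have L := pd_dot openU i ns zs Uu.
have L' := pd_dot openU i vs zs Uu.
have LL : pd i (fun u => dotv (nrm v u) (zeta u)) u =
          pd i (fun u => dotv (v u) (zeta u)) u.
  apply: (pd_ext openU) => // t Ut; rewrite normal_projE normal_part_dot // => k; exact: z0.
have N : dotv (nrm v u) (pd i zeta u) = dotv (v u) (pd i zeta u)
    + (E u)^-1 * (dotv (v u) (pd 0 x u) * dotv (zeta u) (xx i 0 u)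
                  + dotv (v u) (pd 1 x u) * dotv (zeta u) (xx i 1 u)).
  rewrite normal_projE normal_partE // !dotE ![dotv (pd _ x u) _]dotvC !dot_pd_normal //.
  ring.
rewrite L L' N in LL; rewrite ![dotv (xx _ _ _) _]dotvC.
lra.
Qed.

(** The tangential part of d_j eta is given by the Weingarten equation. *)
Lemma normal_pd_twice eta zeta i j u : normal_field eta -> normal_field zeta -> U u ->
  dotv (Dn i (Dn j eta) u) (zeta u) = dotv (pd i (pd j eta) u) (zeta u)
    + (E u)^-1 * (dotv (eta u) (xx j 0 u) * dotv (xx i 0 u) (zeta u)
                  + dotv (eta u) (xx j 1 u) * dotv (xx i 1 u) (zeta u)).
Proof.
move=> en zn Uu; have [es _] := en.
by rewrite normal_pd_proj //; [rewrite !dot_pd_normal //; ring|exact: vsmooth_pd].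
Qed.


Let half_diff_smooth : vsmooth U (fun u => 2^-1 *: (xx 0 0 u - xx 1 1 u)).
Proof.
apply: (@vsmoothZ _ _ _ openU (cst 2^-1)); first exact: smooth_cst.
exact: vsmoothB.
Qed.

Let half_sum_smooth : vsmooth U (fun u => 2^-1 *: (xx 0 0 u + xx 1 1 u)).
Proof.
apply: (@vsmoothZ _ _ _ openU (cst 2^-1)); first exact: smooth_cst.
exact: vsmoothD.
Qed.

Lemma sff_diag_field : normal_field A. Proof. exact: normal_proj_field. Qed.
Lemma sff_off_field : normal_field B. Proof. exact: normal_proj_field. Qed.
Lemma half_trace_field : normal_field h. Proof. exact: normal_proj_field. Qed.
Lemma iso_mean_field : normal_field H.
Proof.
have [hs h0] := half_trace_field; split.
  apply: (vsmooth_ext openU) (vsmoothZ openU smooth_conformal_factorV hs) => u Uu.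
  by rewrite iso_meanE.
by move=> u Uu k; rewrite iso_meanE dotvZl h0 // mulr0.
Qed.

Lemma half_traceE u : U u -> h u = E u *: H u.
Proof. by move=> Uu; rewrite iso_meanE scalerA mulfV ?scale1r ?conformal_factor_neq0. Qed.

Lemma dot_pd2_normal u z : U u -> (forall k, dotv z (pd k x u) = 0) ->
  [/\ dotv (xx 0 0 u) z = E u * dotv (H u) z + dotv (A u) z,
      dotv (xx 1 1 u) z = E u * dotv (H u) z - dotv (A u) z,
      dotv (xx 0 1 u) z = dotv (B u) z & dotv (xx 1 0 u) z = dotv (B u) z].
Proof.
move=> Uu z0; rewrite -!dotvZl -half_traceE // [xx 1 0 u]pd2C //.
rewrite /sff_diag /sff_off /half_trace !normal_projE !normal_part_dot // !dotE.
split=> //; lra.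
Qed.

(** The Christoffel symbols of the first kind, obtained by differentiating
    <d_i x, d_j x> = E delta_ij. *)
Lemma dot_pd2_tangent u : U u ->
  [/\ dotv (xx 0 0 u) (pd 0 x u) = 2^-1 * pd 0 E u,
      dotv (xx 0 0 u) (pd 1 x u) = - (2^-1 * pd 1 E u),
      dotv (xx 1 1 u) (pd 0 x u) = - (2^-1 * pd 0 E u),
      dotv (xx 1 1 u) (pd 1 x u) = 2^-1 * pd 1 E u &
      dotv (xx 0 1 u) (pd 0 x u) = 2^-1 * pd 1 E u /\
      dotv (xx 0 1 u) (pd 1 x u) = 2^-1 * pd 0 E u].
Proof.
move=> Uu.
have D i j k : dotv (xx k i u) (pd j x u) + dotv (pd i x u) (xx k j u) =
    pd k E u *+ (i == j).
  rewrite -(pd_dot openU k (vsmooth_pd_x i) (vsmooth_pd_x j) Uu).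
  have [ij|ij] := eqVneq i j.
    apply: (pd_ext openU) => // t Ut; by rewrite dot_tangent_frame // ij eqxx.
  rewrite mulr0n (@pd_ext _ _ openU _ _ (cst 0)) //; first by rewrite pdE derive_cst.
  by move=> t Ut; rewrite dot_tangent_frame // (negbTE ij).
have D00 k := D 0 0 k; have D01 k := D 0 1 k; have D11 k := D 1 1 k.
move: (D00 0) (D00 1) (D01 0) (D01 1) (D11 0) (D11 1).
rewrite /= ?(mulr1n, mulr0n) ![dotv (pd _ x u) _]dotvC [xx 1 0 u]pd2C // => *.
by split; [lra|lra|lra|lra|split; lra].
Qed.


(** Together with normal_pd_half_trace, this expresses D H without
    dividing by E. *)
Lemma normal_pd_conformal_mean i zeta u : normal_field zeta -> U u ->
  dotv (Dn i h u) (zeta u) =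
  pd i E u * dotv (H u) (zeta u) + E u * dotv (Dn i H u) (zeta u).
Proof.
move=> [zs z0] Uu; rewrite !normal_pdE !normal_part_dot //; try by move=> k; exact: z0.
have -> : pd i h u = pd i (fun t => E t *: H t) u.
  by apply: (pd_ext openU) => // t Ut; exact: half_traceE.
have [Hs _] := iso_mean_field.
by rewrite (pd_vectorZ openU) ?dotE //; exact: smooth_conformal_factor.
Qed.

(** d_0 d_0 x + d_1 d_1 x is already normal in isothermal coordinates, so
    projecting it contributes no correction term. *)
Lemma normal_pd_half_trace i zeta u : normal_field zeta -> U u ->
  dotv (Dn i h u) (zeta u) =
  2^-1 * (dotv (pd i (xx 0 0) u) (zeta u) + dotv (pd i (xx 1 1) u) (zeta u)).
Proof.
move=> zn Uu; rewrite normal_pd_proj //.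
have [e1 e2 e3 e4 _] := dot_pd2_tangent Uu.
rewrite !dotE e1 e2 e3 e4 (pd_vectorZ_cst openU) //; last exact: vsmoothD.
by rewrite (pd_vectorD openU) // ?dotE; ring.
Qed.

Lemma normal_pd_sff_diag i zeta u : normal_field zeta -> U u ->
  dotv (Dn i A u) (zeta u) =
  2^-1 * (dotv (pd i (xx 0 0) u) (zeta u) - dotv (pd i (xx 1 1) u) (zeta u))
  - (E u)^-1 * 2^-1 * (pd 0 E u * dotv (xx i 0 u) (zeta u)
                       - pd 1 E u * dotv (xx i 1 u) (zeta u)).
Proof.
move=> zn Uu; rewrite normal_pd_proj //.
have [e1 e2 e3 e4 _] := dot_pd2_tangent Uu.
rewrite !dotE e1 e2 e3 e4 (pd_vectorZ_cst openU) //; last exact: vsmoothB.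
by rewrite (pd_vectorB openU) // ?dotE; field; exact: conformal_factor_neq0.
Qed.

Lemma normal_pd_sff_off i zeta u : normal_field zeta -> U u ->
  dotv (Dn i B u) (zeta u) = dotv (pd i (xx 0 1) u) (zeta u)
  - (E u)^-1 * 2^-1 * (pd 1 E u * dotv (xx i 0 u) (zeta u)
                       + pd 0 E u * dotv (xx i 1 u) (zeta u)).
Proof.
move=> zn Uu; rewrite normal_pd_proj //.
have [_ _ _ _ [e5 e6]] := dot_pd2_tangent Uu.
by rewrite e5 e6; field; exact: conformal_factor_neq0.
Qed.

Lemma pd_pd2_off u : U u -> pd 0 (xx 0 1) u = pd 1 (xx 0 0) u /\
  pd 1 (xx 0 1) u = pd 0 (xx 1 1) u.
Proof.
move=> Uu; split; last exact: (pd_vectorC openU 1 0 (vsmooth_pd_x 1) Uu).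
rewrite (@pd_ext _ _ openU _ _ (xx 1 0)) //; last by move=> t Ut; exact: pd2C.
exact: (pd_vectorC openU 0 1 (vsmooth_pd_x 0) Uu).
Qed.

(** By symmetry the third derivatives of x combine into those of half_trace; what
    remains is the term with the derivative of E that normal_pd_conformal_mean predicts. *)
Lemma codazzi_weak zeta u : normal_field zeta -> U u ->
  dotv (Dn 0 A u + Dn 1 B u) (zeta u) = E u * dotv (Dn 0 H u) (zeta u) /\
  dotv (Dn 1 A u - Dn 0 B u) (zeta u) = - (E u * dotv (Dn 1 H u) (zeta u)).
Proof.
move=> zn Uu; have [zs z0] := zn.
have [x00 x11 x01 x10] := dot_pd2_normal Uu (z0 _ Uu).
have [t0 t1] := pd_pd2_off Uu.
have h0 := normal_pd_conformal_mean 0 zn Uu; have h1 := normal_pd_conformal_mean 1 zn Uu.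
have h0' := normal_pd_half_trace 0 zn Uu; have h1' := normal_pd_half_trace 1 zn Uu.
rewrite h0' in h0; rewrite h1' in h1.
rewrite !dotE !normal_pd_sff_diag // !normal_pd_sff_off // t0 t1 x00 x11 x01 x10.
have E0 := conformal_factor_neq0 Uu.
split.
- apply: (@addrI _ (pd 0 E u * dotv (H u) (zeta u))); rewrite -h0; by field.
- apply: oppr_inj; rewrite opprK.
  apply: (@addrI _ (pd 1 E u * dotv (H u) (zeta u))); rewrite -h1; by field.
Qed.

(** In complex form, D_zbar Omega = (E / 2) D_z H.  Both differences are normal
    fields, so they may be tested against themselves in codazzi_weak. *)
Lemma codazzi u : U u ->
  Dn 0 A u + Dn 1 B u = E u *: Dn 0 H u /\
  Dn 1 A u - Dn 0 B u = - (E u *: Dn 1 H u).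
Proof.
move=> Uu; have [As _] := sff_diag_field; have [Bs _] := sff_off_field.
have [Hs _] := iso_mean_field.
have F i v : vsmooth U v -> normal_field (Dn i v) by exact: normal_pd_field.
have [[a0s a0] [a1s a1]] := (F 0 _ As, F 1 _ As).
have [[b0s b0] [b1s b1]] := (F 0 _ Bs, F 1 _ Bs).
have [[h0s h0] [h1s h1]] := (F 0 _ Hs, F 1 _ Hs).
pose P t := Dn 0 A t + Dn 1 B t - E t *: Dn 0 H t.
pose Q t := Dn 1 A t - Dn 0 B t + E t *: Dn 1 H t.
have Pn : normal_field P.
  split; last first.
    by move=> t Ut k; rewrite /P !dotE a0 // b1 // h0 // !(mulr0, oppr0, addr0).
  apply: vsmoothB => //; first exact: vsmoothD.
  by apply: vsmoothZ => //; exact: smooth_conformal_factor.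
have Qn : normal_field Q.
  split; last first.
    by move=> t Ut k; rewrite /Q !dotE a1 // b0 // h1 // !(mulr0, oppr0, addr0).
  apply: vsmoothD => //; first exact: vsmoothB.
  by apply: vsmoothZ => //; exact: smooth_conformal_factor.
have [cP _] := codazzi_weak Pn Uu; have [_ cQ] := codazzi_weak Qn Uu.
split; apply/eqP; rewrite -subr_eq0; apply/eqP; apply: dotv_eq0.
  by rewrite -/(P u) {1}/P dotvDl cP dotvNl dotvZl subrr.
by rewrite opprK -/(Q u) {1}/Q dotvDl cQ dotvZl addNr.
Qed.

(** The second derivatives of H cancel by symmetry; the quadratic terms of
    normal_pd_twice are the normal curvature. *)
Lemma ricci zeta u : normal_field zeta -> U u ->
  dotv (Dn 0 (Dn 1 H) u) (zeta u) - dotv (Dn 1 (Dn 0 H) u) (zeta u) =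
  2 * (E u)^-1 * (dotv (H u) (B u) * dotv (A u) (zeta u)
                  - dotv (H u) (A u) * dotv (B u) (zeta u)).
Proof.
move=> zn Uu; have Hn := iso_mean_field; have [zs z0] := zn; have [Hs H0] := Hn.
rewrite !normal_pd_twice // [pd 0 (pd 1 H) u](pd_vectorC openU) //.
rewrite ![dotv (H u) (xx _ _ _)]dotvC.
have [-> -> -> ->] := dot_pd2_normal Uu (z0 _ Uu).
have [-> -> -> ->] := dot_pd2_normal Uu (H0 _ Uu).
rewrite [dotv (A u) (H u)]dotvC ?[dotv (B u) (H u)]dotvC.
by field; exact: conformal_factor_neq0.
Qed.

Section Willmore.
Hypothesis conf_norm : forall u, U u -> dotv (A u) (A u) = dotv (B u) (B u).
Hypothesis conf_orth : forall u, U u -> dotv (A u) (B u) = 0.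
Hypothesis willmore_eq : forall u, U u ->
  Dn 0 (Dn 0 H) u + Dn 1 (Dn 1 H) u =
  - (2 * (E u)^-1) *: (dotv (H u) (A u) *: A u + dotv (H u) (B u) *: B u).

Local Notation P u := (Dn 0 A u + Dn 1 B u).
Local Notation Q u := (Dn 1 A u - Dn 0 B u).

(** The real and imaginary parts of <D_zbar Omega, Omega> = 0, which is the
    zbar-derivative of <Omega, Omega> = 0. *)
Lemma dbar_isotropic u : U u ->
  dotv (P u) (A u) + dotv (Q u) (B u) = 0 /\ dotv (Q u) (A u) - dotv (P u) (B u) = 0.
Proof.
move=> Uu; have An := sff_diag_field; have Bn := sff_off_field.
have N i : pd i (fun u => dotv (A u) (A u)) u = pd i (fun u => dotv (B u) (B u)) u.
  by apply: (pd_ext openU).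
have O i : pd i (fun u => dotv (A u) (B u)) u = 0.
  by rewrite (@pd_ext _ _ openU _ _ (cst 0)) // pdE derive_cst.
move: (N 0) (N 1) (O 0) (O 1); rewrite !pd_dot_normal // !dotE.
rewrite ![dotv (A u) (Dn _ _ _)]dotvC ![dotv (B u) (Dn _ _ _)]dotvC => *.
split; lra.
Qed.

(** The real and imaginary parts of <D_zbar Omega, D_zbar Omega> = 0.  By Codazzi
    dbar_isotropic is a statement about D H; differentiating it once more yields
    second normal derivatives of H only in the combinations D_0 D_0 H + D_1 D_1 H and
    D_0 D_1 H - D_1 D_0 H, given by the Willmore and Ricci equations, and these two
    contributions cancel. *)
Lemma dbar_square_isotropic u : U u ->
  dotv (P u) (P u) = dotv (Q u) (Q u) /\ dotv (P u) (Q u) = 0.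
Proof.
move=> Uu; have An := sff_diag_field; have Bn := sff_off_field.
have [Hs _] := iso_mean_field.
have H0n := normal_pd_field 0 Hs; have H1n := normal_pd_field 1 Hs.
(* <D_z H, Omega> = 0 in real terms *)
have F t : U t -> dotv (Dn 0 H t) (A t) = dotv (Dn 1 H t) (B t) /\
                  dotv (Dn 1 H t) (A t) = - dotv (Dn 0 H t) (B t).
  move=> Ut; have [cP cQ] := codazzi Ut; have := dbar_isotropic Ut.
  rewrite cP cQ !dotE => -[e1 e2]; have E0 := conformal_factor_neq0 Ut.
  by split; apply: (mulfI E0); lra.
have G1 i : pd i (fun u => dotv (Dn 0 H u) (A u)) u =
            pd i (fun u => dotv (Dn 1 H u) (B u)) u.
  by apply: (pd_ext openU) => // t Ut; case: (F t Ut).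
have G2 i : pd i (fun u => dotv (Dn 1 H u) (A u)) u =
            - pd i (fun u => dotv (Dn 0 H u) (B u)) u.
  have s : smooth U (fun u => dotv (Dn 0 H u) (B u)).
    by apply: smooth_dot => //; [case: H0n|case: Bn].
  have -> : - pd i (fun u => dotv (Dn 0 H u) (B u)) u =
            pd i (fun u => - dotv (Dn 0 H u) (B u)) u.
    by rewrite !pdE -[LHS]deriveN //; exact: (smooth_derivable s Uu).
  by apply: (pd_ext openU) => // t Ut; case: (F t Ut).
have Ra := ricci An Uu; have Rb := ricci Bn Uu.
have Wa : dotv (Dn 0 (Dn 0 H) u + Dn 1 (Dn 1 H) u) (A u) =
   - (2 * (E u)^-1) * (dotv (H u) (A u) * dotv (A u) (A u)).
  by rewrite willmore_eq // !dotE [dotv (B u) (A u)]dotvC conf_orth // mulr0 addr0.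
have Wb : dotv (Dn 0 (Dn 0 H) u + Dn 1 (Dn 1 H) u) (B u) =
   - (2 * (E u)^-1) * (dotv (H u) (B u) * dotv (B u) (B u)).
  by rewrite willmore_eq // !dotE conf_orth // mulr0 add0r.
rewrite [dotv (B u) (A u)]dotvC conf_orth // mulr0 subr0 in Ra.
rewrite conf_orth // mulr0 sub0r in Rb.
rewrite dotvDl in Wa; rewrite dotvDl in Wb.
move: (G1 0) (G1 1) (G2 0) (G2 1); rewrite !pd_dot_normal // => g10 g11 g20 g21.
rewrite conf_norm // in Ra Wa.
have [cP cQ] := codazzi Uu; have E0 := conformal_factor_neq0 Uu.
(* the divergence and the curl of the pair of identities F *)
have N1 : dotv (Dn 0 H u) (P u) + dotv (Dn 1 H u) (Q u) = 0.
  rewrite !dotE; lra.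
have N2 : dotv (Dn 0 H u) (Q u) - dotv (Dn 1 H u) (P u) = 0.
  rewrite !dotE; lra.
rewrite cP cQ !dotE in N1 N2 *.
rewrite [dotv (Dn 1 H u) (Dn 0 H u)]dotvC in N2.
move: (dotv (Dn 0 H u) (Dn 0 H u)) (dotv (Dn 0 H u) (Dn 1 H u))
      (dotv (Dn 1 H u) (Dn 1 H u)) N1 N2 => a b c N1 N2.
have ac : a = c by apply: (mulfI E0); lra.
have b0 : b = 0 by apply: (mulfI E0); lra.
by rewrite ac b0; split; ring.
Qed.

End Willmore.
End Geometry.

(** * The coordinate-free invariants in isothermal coordinates *)

Lemma basisvE (R : realType) (i j : 'I_2) : basisv R i 0 j = (j == i)%:R.
Proof. by rewrite mxE. Qed.

Section Invariants.
Variables (R : realType) (n : nat) (U : set 'rV[R]_2) (x : 'rV[R]_2 -> 'rV[R]_n).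
Hypothesis openU : open U.
Hypothesis xs : vsmooth U x.
Hypothesis iso : isothermal x U.
Implicit Types (v eta zeta : 'rV[R]_2 -> 'rV[R]_n) (i j k : 'I_2) (u X Y : 'rV[R]_2).

Local Notation E := (conformal_factor x).
Local Notation xx i j := (pd2 i j x).
Local Notation Dn := (normal_pd x).
Local Notation A := (sff_diag x).
Local Notation B := (sff_off x).
Local Notation H := (iso_mean x).
Local Notation np := (normal_part x).

Lemma normal_part_lin u (a b : R) (v w : 'rV[R]_n) : U u ->
  np u (a *: v + b *: w) = a *: np u v + b *: np u w.
Proof.
move=> Uu; rewrite !(normal_partE iso) // !dotE.
move: (pd 0 x u) (pd 1 x u) => p q; apply/rowP => k; rewrite !mxE; ring.
Qed.

Lemma normal_partZ u (a : R) (v : 'rV[R]_n) : U u -> np u (a *: v) = a *: np u v.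
Proof.
move=> Uu; have := @normal_part_lin u a 0 v 0 Uu.
by rewrite !scale0r !addr0.
Qed.

Lemma normal_part_pd2 u : U u ->
  [/\ np u (xx 0 0 u) = E u *: H u + A u, np u (xx 1 1 u) = E u *: H u - A u,
      np u (xx 0 1 u) = B u & np u (xx 1 0 u) = B u].
Proof.
move=> Uu; rewrite -(half_traceE iso) // (pd2C openU xs 1 0 Uu).
rewrite /half_trace /sff_diag /sff_off.
rewrite !normal_projE.
have D (s : R) : np u (2^-1 *: (xx 0 0 u + s *: xx 1 1 u)) =
   2^-1 *: np u (xx 0 0 u) + (2^-1 * s) *: np u (xx 1 1 u).
  by rewrite scalerDr scalerA normal_part_lin.
have := D 1; have := D (-1); rewrite scale1r scaleN1r => -> ->.
move: (np u _) (np u _) => p q; split=> //; apply/rowP => k; rewrite !mxE; lra.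
Qed.

(** The section eta need agree with the smooth field v on the chart only, as the
    mean curvature and the Hopf form do with their isothermal expressions. *)
Lemma normal_conn_ext v eta (X : 'rV[R]_2 -> 'rV[R]_2) u :
  (forall t, U t -> eta t = v t) -> vsmooth U v -> U u ->
  normal_conn x X eta u = X u 0 0 *: Dn 0 v u + X u 0 1 *: Dn 1 v u.
Proof.
move=> ev vs Uu; rewrite /normal_conn !normal_pdE -normal_part_lin //; congr (np u _).
rewrite -(derive_vsmooth openU (X u) vs Uu); apply: near_eq_derive.
exact: (@near_open _ _ openU (fun t => eta t = v t) u Uu ev).
Qed.

Lemma second_ffE X Y u : U u -> second_ff x (cst X) (cst Y) u =
  (X 0 0 * Y 0 0) *: (E u *: H u + A u) + (X 0 1 * Y 0 1) *: (E u *: H u - A u)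
  + (X 0 0 * Y 0 1 + X 0 1 * Y 0 0) *: B u.
Proof.
move=> Uu; pose v t := Y 0 0 *: pd 0 x t + Y 0 1 *: pd 1 x t.
have s0 : vsmooth U (fun t => Y 0 0 *: pd 0 x t).
  apply: (@vsmoothZ _ _ _ openU (cst (Y 0 0))); first exact: smooth_cst.
  exact: vsmooth_pd.
have s1 : vsmooth U (fun t => Y 0 1 *: pd 1 x t).
  apply: (@vsmoothZ _ _ _ openU (cst (Y 0 1))); first exact: smooth_cst.
  exact: vsmooth_pd.
have vs : vsmooth U v by exact: vsmoothD.
have pv i : pd i v u = Y 0 0 *: xx i 0 u + Y 0 1 *: xx i 1 u.
  rewrite (pd_vectorD openU i s0 s1 Uu) !(pd_vectorZ_cst openU) //; exact: vsmooth_pd.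
transitivity (normal_conn x (cst X) (fun t => 'D_Y x t) u); first by [].
rewrite (@normal_conn_ext v) //; last by move=> t Ut; exact: (derive_vsmooth openU Y xs Ut).
rewrite /cst !normal_pdE !pv !normal_part_lin //.
have [-> -> -> ->] := normal_part_pd2 Uu.
move: (H u) (A u) (B u) => p q r; apply/rowP => k; rewrite !mxE; ring.
Qed.

Lemma inner_isothermal X Y u : U u ->
  inner x u X Y = E u * (X 0 0 * Y 0 0 + X 0 1 * Y 0 1).
Proof.
move=> Uu; rewrite /inner (metric_isothermal iso) // !sum_ord2 !mxE /=.
by rewrite !(mulr1n, mulr0n); ring.
Qed.

(** Unit tangent vectors are (c, s) / sqrt E with c ^ 2 + s ^ 2 = 1, and on them
    alpha is H + (c ^ 2 - s ^ 2) A / E + 2 c s B / E. *)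
Lemma superconformal_isothermal u : U u ->
  nondegenerate_circle (curvature_ellipse x u) ->
  [/\ A u != 0, dotv (A u) (A u) = dotv (B u) (B u) & dotv (A u) (B u) = 0].
Proof.
move=> Uu circ; have E0 := conformal_factor_neq0 iso Uu.
have Eg := conformal_factor_gt0 iso Uu.
pose l := Num.sqrt (E u).
have l0 : l != 0 by rewrite lt0r_neq0 // sqrtr_gt0.
have ll : l ^+ 2 = E u by rewrite sqr_sqrtr // ltW.
have := @circle_conformal _ _ (H u) ((E u)^-1 *: A u) ((E u)^-1 *: B u) _ _ circ.
case.
  move=> y; split.
  - move=> [X /= X1 <-]; exists (l * X 0 0), (l * X 0 1).
    rewrite inner_isothermal // in X1.
    have I0 : 0 <= E u * (X 0 0 * X 0 0 + X 0 1 * X 0 1).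
      by apply: mulr_ge0; [exact: ltW|rewrite -!expr2 addr_ge0 ?sqr_ge0].
    have := sqr_sqrtr I0; rewrite X1 expr1n => e.
    split; first by rewrite e -ll; ring.
    rewrite second_ffE // !exprMn ll.
    have -> : 2 * (l * X 0 0) * (l * X 0 1) = 2 * E u * X 0 0 * X 0 1.
      rewrite -ll; ring.
    move: (H u) (A u) (B u) => p q r; apply/rowP => k; rewrite !mxE.
    by rewrite -[in RHS](mul1r (p 0 k)) {1}e; field.
  - move=> [c [s [cs ->]]].
    pose X : 'rV[R]_2 := (c / l) *: basisv R 0 + (s / l) *: basisv R 1.
    have X0 : X 0 0 = c / l by rewrite !mxE /= !(mulr1, mulr0, addr0).
    have X1 : X 0 1 = s / l by rewrite !mxE /= !(mulr1, mulr0, add0r).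
    clearbody X.
    have e : E u * (X 0 0 * X 0 0 + X 0 1 * X 0 1) = 1.
      by rewrite X0 X1 -ll -cs; field.
    exists X; first by rewrite /= inner_isothermal // e sqrtr1.
    rewrite second_ffE //.
    move: (H u) (A u) (B u) => p q r; apply/rowP => k; rewrite !mxE.
    by rewrite -[in RHS](mul1r (p 0 k)) -{1}e X0 X1 -ll; field.
rewrite !dotE => a0 ab orth.
have Ei : (E u)^-1 != 0 by rewrite invr_eq0.
split.
- by apply: contra_neq a0 => ->; rewrite scaler0.
- by apply: (mulfI Ei); apply: (mulfI Ei).
- by apply: (mulfI Ei); apply: (mulfI Ei); rewrite orth !mulr0.
Qed.


Lemma metric_trace_isothermal (T : ('rV[R]_2 -> 'rV[R]_2) -> ('rV[R]_2 -> 'rV[R]_2) ->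
    'rV[R]_2 -> 'rV[R]_n) u : U u ->
  metric_trace x T u = (E u)^-1 *: (T (cst (basisv R 0)) (cst (basisv R 0)) u
                                    + T (cst (basisv R 1)) (cst (basisv R 1)) u).
Proof.
move=> Uu; rewrite /metric_trace (metric_isothermal iso) // invmx_scalar.
rewrite sum_ord2 [X in X + _]sum_ord2 [X in _ + X]sum_ord2.
move: (T _ _ u) (T _ _ u) (T _ _ u) (T _ _ u) => p q r s.
by rewrite !mxE !mulr1n !mulr0n !scale0r addr0 add0r scalerDr.
Qed.

Lemma mean_curvatureE u : U u -> mean_curvature x u = H u.
Proof.
move=> Uu; rewrite /mean_curvature metric_trace_isothermal // !second_ffE // !basisvE.
move: (H u) (A u) (B u) (conformal_factor_neq0 iso Uu) => p q r E0.
apply/rowP => k; rewrite !mxE /=.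
by field.
Qed.

Lemma dmetric_isothermal u l i j : U u -> dmetric x u l i j = pd l E u *+ (i == j).
Proof.
move=> Uu; rewrite /dmetric pd_at.
have Es := smooth_conformal_factor openU xs.
have [->|ij] := eqVneq i j.
  by apply: (pd_ext openU) => // t Ut; rewrite (metric_isothermal iso) // mxE eqxx.
rewrite (@pd_ext _ _ openU _ _ (cst 0)) //; first by rewrite pdE derive_cst.
by move=> t Ut; rewrite (metric_isothermal iso) // mxE (negbTE ij).
Qed.

Lemma christoffel_isothermal u k i j : U u -> christoffel x u k i j =
  2^-1 * (E u)^-1 * (pd i E u *+ (j == k) + pd j E u *+ (i == k) - pd k E u *+ (i == j)).
Proof.
move=> Uu; rewrite /christoffel (metric_isothermal iso) // invmx_scalar sum_ord2.
rewrite !dmetric_isothermal // -mulrA; congr (_ * _).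
by have [->|->] := ord2_cases k; rewrite !mxE /= ?mulr1n ?mulr0n ?mul0r ?addr0 ?add0r.
Qed.

Lemma levi_civita_frame u i k : U u ->
  levi_civita x (cst (basisv R i)) (cst (basisv R i)) u 0 k =
  2^-1 * (E u)^-1 * (2 * pd i E u *+ (i == k) - pd k E u).
Proof.
move=> Uu; rewrite /levi_civita derive_cst add0r mxE.
rewrite sum_ord2 [X in X + _]sum_ord2 [X in _ + X]sum_ord2.
rewrite /cst !basisvE !christoffel_isothermal //.
have [->|->] := ord2_cases i;
  rewrite /= !(mulr1n, mulr0n, mulr0, mul0r, mulr1, mul1r, addr0, add0r);
  by rewrite mulr_natl mulr2n mulrnDl.
Qed.

(** The sum over i of the covariant derivatives of d_i along itself vanishes in
    isothermal coordinates, so the Laplacian has no first-order term. *)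
Lemma normal_laplacian_isothermal u : U u ->
  normal_laplacian x (mean_curvature x) u =
  (E u)^-1 *: (Dn 0 (Dn 0 H) u + Dn 1 (Dn 1 H) u).
Proof.
move=> Uu; have [Hs _] := iso_mean_field openU xs iso.
have HD i t : U t -> normal_conn x (cst (basisv R i)) (mean_curvature x) t = Dn i H t.
  move=> Ut; rewrite /normal_conn normal_pdE pd_at; congr (np t _).
  by apply: (pd_ext openU) => // s; exact: mean_curvatureE.
have HDD i : normal_conn x (cst (basisv R i))
    (normal_conn x (cst (basisv R i)) (mean_curvature x)) u = Dn i (Dn i H) u.
  rewrite /normal_conn normal_pdE pd_at; congr (np u _).
  by apply: (pd_ext openU) => // s; exact: HD.
have L i : normal_conn x (levi_civita x (cst (basisv R i)) (cst (basisv R i)))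
      (mean_curvature x) u =
    levi_civita x (cst (basisv R i)) (cst (basisv R i)) u 0 0 *: Dn 0 H u +
    levi_civita x (cst (basisv R i)) (cst (basisv R i)) u 0 1 *: Dn 1 H u.
  by rewrite (@normal_conn_ext H) //; exact: mean_curvatureE.
rewrite /normal_laplacian metric_trace_isothermal // /normal_hessian !HDD !L.
rewrite !levi_civita_frame //=.
move: (Dn 0 (Dn 0 H) u) (Dn 1 (Dn 1 H) u) (Dn 0 H u) (Dn 1 H u) => p q r s.
by congr (_ *: _); apply/rowP => k; rewrite !mxE; field; exact: (conformal_factor_neq0 iso).
Qed.

(** The Willmore equation in the orthonormal frame d_i / sqrt E: the terms in |H| ^ 2
    cancel, because the trace part of alpha contributes 2 |H| ^ 2 H to the last sum. *)
Lemma willmore_isothermal u : U u ->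
  (forall X : 'I_2 -> 'rV[R]_2,
    (forall i j, inner x u (X i) (X j) = (i == j)%:R) ->
    let alpha i j := second_ff x (cst (X i)) (cst (X j)) u in
    normal_laplacian x (mean_curvature x) u
      - (2 * dotv (mean_curvature x u) (mean_curvature x u)) *: mean_curvature x u
      + \sum_(i < 2) \sum_(j < 2)
          dotv (mean_curvature x u) (alpha i j) *: alpha i j = 0) ->
  Dn 0 (Dn 0 H) u + Dn 1 (Dn 1 H) u =
  - (2 * (E u)^-1) *: (dotv (H u) (A u) *: A u + dotv (H u) (B u) *: B u).
Proof.
move=> Uu W; have E0 := conformal_factor_neq0 iso Uu.
have Eg := conformal_factor_gt0 iso Uu.
pose l := Num.sqrt (E u).
have l0 : l != 0 by rewrite lt0r_neq0 // sqrtr_gt0.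
have ll : l ^+ 2 = E u by rewrite sqr_sqrtr // ltW.
pose X i := l^-1 *: basisv R i.
have Xc i j : X i 0 j = l^-1 * (j == i)%:R by rewrite mxE basisvE.
have XX i j : inner x u (X i) (X j) = (i == j)%:R.
  rewrite inner_isothermal // !Xc -ll.
  by have [->|->] := ord2_cases i; have [->|->] := ord2_cases j; rewrite /=; field.
have /= := W X XX; clearbody X.
rewrite normal_laplacian_isothermal // mean_curvatureE //.
rewrite sum_ord2 [X in _ + (X + _)]sum_ord2 [X in _ + (_ + X)]sum_ord2.
rewrite !second_ffE // !Xc /=.
rewrite !(mulr1, mulr0, mul0r, addr0, add0r, scale0r).
have lE : l^-1 * l^-1 = (E u)^-1 by rewrite -ll expr2 invfM.
rewrite lE !dotE.
move: (dotv (H u) (H u)) (dotv (H u) (A u)) (dotv (H u) (B u)) => hh ha hb.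
move: (Dn 0 (Dn 0 H) u + Dn 1 (Dn 1 H) u) (H u) (A u) (B u) => D p q r /rowP Z.
apply/rowP => k; have := Z k; rewrite !mxE => Zk.
apply: (mulfI (invr_neq0 E0)); apply/eqP; rewrite -subr_eq0 -[X in _ == X]Zk; apply/eqP.
by field.
Qed.

End Invariants.

(** * Complex second fundamental form *)

Lemma re_complex_row (R : realType) n (a b : 'rV[R]_n) : re_row (complex_row a b) = a.
Proof. by apply/rowP => j; rewrite !mxE. Qed.

Lemma im_complex_row (R : realType) n (a b : 'rV[R]_n) : im_row (complex_row a b) = b.
Proof. by apply/rowP => j; rewrite !mxE. Qed.

Lemma complex_row_re_im (R : realType) n (Z : 'rV[R[i]]_n) :
  complex_row (re_row Z) (im_row Z) = Z.
Proof. by apply/rowP => j; rewrite !mxE; case: (Z 0 j). Qed.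

(** Stated with the first field constant, as both coordinate fields are. *)
Lemma complexify_cst (R : realType) m n k
  (T : ('rV[R]_2 -> 'rV[R]_m) -> ('rV[R]_2 -> 'rV[R]_n) -> 'rV[R]_2 -> 'rV[R]_k)
  (a b : 'rV[R]_m) (c d : 'rV[R]_2 -> 'rV[R]_n) (u : 'rV[R]_2) :
  complexify T (cst (complex_row a b)) (fun w => complex_row (c w) (d w)) u =
  complex_row (T (cst a) c u - T (cst b) d u) (T (cst a) d u + T (cst b) c u).
Proof.
rewrite /complexify.
have -> : @re_row R m \o cst (complex_row a b) = cst a :> ('rV[R]_2 -> 'rV[R]_m).
  by apply/funext => w /=; exact: re_complex_row.
have -> : @im_row R m \o cst (complex_row a b) = cst b :> ('rV[R]_2 -> 'rV[R]_m).
  by apply/funext => w /=; exact: im_complex_row.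
have -> : @re_row R n \o (fun w => complex_row (c w) (d w)) = c.
  by apply/funext => w /=; exact: re_complex_row.
have -> : @im_row R n \o (fun w => complex_row (c w) (d w)) = d.
  by apply/funext => w /=; exact: im_complex_row.
by [].
Qed.

Lemma complex_row_scale (R : realType) n (r s : R) (a b : 'rV[R]_n) :
  complex_row (r *: a + s *: b) (s *: a - r *: b) =
  Complex r s *: complex_row a (- b).
Proof.
apply/rowP => j; rewrite !mxE; apply/eqP; rewrite eq_complex /=.
by apply/andP; split; apply/eqP; ring.
Qed.


Section Complexified.
Variables (R : realType) (n : nat) (U : set 'rV[R]_2) (x : 'rV[R]_2 -> 'rV[R]_n).
Hypothesis openU : open U.
Hypothesis xs : vsmooth U x.
Hypothesis iso : isothermal x U.
Implicit Types (u : 'rV[R]_2).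

Local Notation Dn := (normal_pd x).
Local Notation A := (sff_diag x).
Local Notation B := (sff_off x).

Local Notation Omega := (complexify (second_ff x) (@d_z R) (@d_z R)).

Lemma hopf_form u : U u ->
  Omega u = complex_row (2^-1 *: A u) (- (2^-1 *: B u)).
Proof.
move=> Uu; rewrite /d_z.
have := @complexify_cst R 2 2 n (second_ff x) (2^-1 *: basisv R 0) (- 2^-1 *: basisv R 1)
  (cst (2^-1 *: basisv R 0)) (cst (- 2^-1 *: basisv R 1)) u.
rewrite /cst => ->; rewrite -!/(cst _).
have c0 i j (a : R) : (a *: basisv R i) 0 j = a * (j == i)%:R by rewrite !mxE.
rewrite !(second_ffE openU xs iso) // !c0 /=.
move: (iso_mean x u) (A u) (B u) => p q r.
by congr complex_row; apply/rowP => k; rewrite !mxE; field.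
Qed.

Lemma dbar_hopf_form u : U u ->
  complexify (normal_conn x) (@d_zbar R) Omega u =
  complex_row (4^-1 *: (Dn 0 A u + Dn 1 B u)) (4^-1 *: (Dn 1 A u - Dn 0 B u)).
Proof.
move=> Uu; pose c w := re_row (Omega w); pose d w := im_row (Omega w).
have [As _] := sff_diag_field openU xs iso; have [Bs _] := sff_off_field openU xs iso.
have sA : vsmooth U (fun w => 2^-1 *: A w).
  by apply: (@vsmoothZ _ _ _ openU (cst 2^-1)) => //; exact: smooth_cst.
have sB : vsmooth U (fun w => (- 2^-1) *: B w).
  by apply: (@vsmoothZ _ _ _ openU (cst (- 2^-1))) => //; exact: smooth_cst.
have cE w : U w -> c w = 2^-1 *: A w.
  by move=> Uw; rewrite /c hopf_form // re_complex_row.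
have dE w : U w -> d w = (- 2^-1) *: B w.
  by move=> Uw; rewrite /d hopf_form // im_complex_row scaleNr.
have -> : Omega = (fun w => complex_row (c w) (d w)).
  by apply/funext => w; rewrite /c /d complex_row_re_im.
rewrite complexify_cst.
have c0 i j (a : R) : (a *: basisv R i) 0 j = a * (j == i)%:R by rewrite !mxE.
have DA i : Dn i (fun w => 2^-1 *: A w) u = 2^-1 *: Dn i A u.
  by rewrite !normal_pdE (pd_vectorZ_cst openU) // (normal_partZ iso).
have DB i : Dn i (fun w => (- 2^-1) *: B w) u = (- 2^-1) *: Dn i B u.
  by rewrite !normal_pdE (pd_vectorZ_cst openU) // (normal_partZ iso).
rewrite !(normal_conn_ext openU iso _ cE sA Uu) !(normal_conn_ext openU iso _ dE sB Uu).
rewrite /cst !c0 /= !DA !DB.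
move: (Dn 0 A u) (Dn 1 A u) (Dn 0 B u) (Dn 1 B u) => p q r s.
by congr complex_row; apply/rowP => k; rewrite !mxE; field.
Qed.

End Complexified.

Theorem theorem2 (R : realType) (M : surface R) (f : M -> 'rV[R]_5)
    (hf : smooth_immersion f) (hsc : superconformal f) (hW : willmore f) :
  s_willmore f.
Proof.
move=> c hc x iso Omega u Uu.
have openU := @chart_img_open R M c; have [hs _] := hf c hc.
have xs : vsmooth (chart_img c) x by exact: vsmooth_smooth_on.
have conf w : chart_img c w -> [/\ sff_diag x w != 0,
    dotv (sff_diag x w) (sff_diag x w) = dotv (sff_off x w) (sff_off x w) &
    dotv (sff_diag x w) (sff_off x w) = 0].
  move=> Uw; apply: (superconformal_isothermal openU xs iso Uw).
  have := hsc c hc _ (chart_inv_dom Uw); by rewrite chart_invK.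
have W w (Uw : chart_img c w) := willmore_isothermal openU xs iso Uw (hW c hc w Uw).
have norm w (Uw : chart_img c w) : _ := let: And3 _ e _ := conf w Uw in e.
have orth w (Uw : chart_img c w) : _ := let: And3 _ _ e := conf w Uw in e.
have [a0 _ _] := conf u Uu.
have [e1 e2] := dbar_isotropic openU xs iso norm orth Uu.
have [e3 e4] := dbar_square_isotropic openU xs iso norm orth W Uu.
have [As A0] := sff_diag_field openU xs iso; have [Bs B0] := sff_off_field openU xs iso.
have D0 v i k : vsmooth (chart_img c) v -> dotv (pd k x u) (normal_pd x i v u) = 0.
  move=> vs; have [_ z] := normal_pd_field openU xs iso i vs.
  by rewrite dotvC z.
have tang k v : v \in [:: sff_diag x u; sff_off x u;
      normal_pd x 0 (sff_diag x) u + normal_pd x 1 (sff_off x) u;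
      normal_pd x 1 (sff_diag x) u - normal_pd x 0 (sff_off x) u] ->
    dotv (pd k x u) v = 0.
  rewrite !inE => /or4P[] /eqP ->.
  - by rewrite dotvC A0.
  - by rewrite dotvC B0.
  - by rewrite dotvDr !D0 ?addr0.
  - by rewrite dotvDr dotvNr !D0 ?oppr0 ?addr0.
have t0 k : pd k x u != 0.
  apply/eqP => t0; have := dot_tangent_frame iso k k Uu; rewrite t0 dotv0 eqxx.
  by move/esym/eqP; rewrite mulr1n (negbTE (conformal_factor_neq0 iso Uu)).
have t01 : dotv (pd 0 x u) (pd 1 x u) = 0 by rewrite (dot_tangent_frame iso).
have [r [s [Pr Qs]]] := isotropic_parallel (leqnn 5) (t0 0) (t0 1) t01
  (fun v hv => conj (tang 0 v hv) (tang 1 v hv)) a0 (norm u Uu) (orth u Uu) e3 e4 e1 e2.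
(* 4 D_zbar Omega = (r + i s) (A - i B) = 2 (r + i s) Omega *)
exists (Complex (2^-1 * r) (2^-1 * s)).
rewrite /Omega (dbar_hopf_form openU xs iso Uu) (hopf_form openU xs iso Uu) Pr Qs.
rewrite -complex_row_scale.
move: (sff_diag x u) (sff_off x u) => a b.
by congr complex_row; apply/rowP => j; rewrite !mxE; field.
Qed.
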